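(* For every face $F$ of $ASM_n$, the dimension of $F$ equals the number of doubly directed regions in the elementary flow grid $g(F)$. In particular, the edges (one-dimensional faces) of $ASM_n$ are represented by the elementary flow grids containing exactly one cycle of double directed edges.
   Context: An alternating sign matrix (ASM) is a square matrix with entries in $\{0,1,-1\}$ such that the entries of each row and each column sum to $1$, and the nonzero entries in each row and each column alternate in sign. $ASM_n$ is the convex hull in $\mathbb{R}^{n^2}$ of the $n\times n$ ASMs; its vertices are the ASMs. The complete flow grid $C_n$ is the directed graph with internal vertices $(i,j)$, $1\le i,j\le n$, and boundary vertices $(i,0),(0,j),(i,n+1),(n+1,j)$, $1\le i,j\le n$ (vertex $(i,j)$ drawn at row $i$, column $j$ of a grid), with edge set $\{((i,j),(i,j\pm1)),((i,j),(i\pm1,j)) : 1\le i,j\le n\}$. A simple flow grid of order $n$ is a subgraph of $C_n$ containing all vertices of $C_n$ in which each internal vertex has exactly four incident edges, either all directed inward, all directed outward, or with the two horizontal edges pointing in the same direction and the two vertical edges pointing in the same direction. For an ASM $A=(a_{ij})$, $g(A)$ is the simple flow grid containing an edge $(v,w)$ of $C_n$, $v=(i,j)$, iff the partial sum of the row (for horizontal $(v,w)$) or column (for vertical $(v,w)$) of $A$ from the border on the side opposite $w$ up to and including $a_{ij}$ equals $1$. For a face $F$, $g(F)=\bigcup_{A \text{ vertex of } F} g(A)$ (union of edge sets). An elementary flow grid is a subgraph of $C_n$ whose edge set is a union of edge sets of simple flow grids. In an elementary flow grid $G$, a double directed edge is a pair of neighbouring vertices joined by edges in both directions; a doubly directed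 region is a collection of cells (unit squares of the drawn grid) completely bounded by double directed edges of $G$ but containing no double directed edges of $G$ in its interior. *)

(* Defs.v *)
From HB Require Import structures.
From mathcomp Require Import all_boot all_order all_algebra.
From mathcomp Require Import boolp classical_sets reals.

Set Implicit Arguments.
Unset Strict Implicit.
Unset Printing Implicit Defensive.

Import Order.TTheory GRing.Theory Num.Theory.
Local Open Scope ring_scope.

Section Polytopes.
Variables (R : realType) (n : nat).
Implicit Types (S P F : set 'M[R]_n) (A X : 'M[R]_n).

Definition conv_hull S : set 'M[R]_n :=
  [set X | exists (k : nat) (p : 'I_k -> 'M[R]_n) (a : 'I_k -> R),
     [/\ forall i, S (p i), forall i, 0 <= a i, \sum_i a i = 1
       & X = \sum_i a i *: p i]]%classic.

Definition aff_hull S : set 'M[R]_n :=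
  [set X | exists (k : nat) (p : 'I_k -> 'M[R]_n) (a : 'I_k -> R),
     [/\ forall i, S (p i), \sum_i a i = 1 & X = \sum_i a i *: p i]]%classic.

(* The affine hull of S is a translate of a d-dimensional linear subspace;
   the empty set has no dimension in this sense. *)
Definition has_dim S (d : nat) : Prop :=
  exists (X0 : 'M[R]_n) (U : {vspace 'M[R]_n}),
    aff_hull S = [set X | X - X0 \in U]%classic /\ \dim U = d.

Definition dotmx A X : R := \sum_i \sum_j A i j * X i j.

(* Both improper faces are included: P itself (C = 0, b = 0) and the empty set
   (C = 0, b = 1). *)
Definition is_face P F : Prop :=
  exists (C : 'M[R]_n) (b : R),
    (forall X, P X -> dotmx C X <= b) /\
    F = [set X | P X /\ dotmx C X = b]%classic.

Definition is_vertex P A : Prop := is_face P [set A]%classic.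

Definition is_ASM A : Prop :=
  [/\ forall i j, [\/ A i j = 0, A i j = 1 | A i j = -1],
      forall i, \sum_j A i j = 1,
      forall j, \sum_i A i j = 1,
      forall i (j k : 'I_n), (j < k)%N -> A i j != 0 -> A i k != 0 ->
        (forall l : 'I_n, (j < l < k)%N -> A i l = 0) -> A i k = - A i j
    & forall j (i k : 'I_n), (i < k)%N -> A i j != 0 -> A k j != 0 ->
        (forall l : 'I_n, (i < l < k)%N -> A l j = 0) -> A k j = - A i j].

Definition ASM_polytope : set 'M[R]_n := conv_hull is_ASM.

End Polytopes.

Section FlowGrids.
Variable n : nat.

(* (i, j) is the vertex at row i, column j of the drawn grid, 0 <= i, j <= n+1.
   The four extra pairs (0, 0), (0, n+1), (n+1, 0), (n+1, n+1) are not vertices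
   of the complete flow grid; no edge of it is incident to them. *)
Definition vertex : finType := ('I_n.+2 * 'I_n.+2)%type.
(* (v, w) is directed from v to w.  Since all grids have the same vertices, a
   grid is identified with its edge set. *)
Definition edge : finType := (vertex * vertex)%type.
Definition grid : finType := {set edge}.

Definition internal (v : vertex) : bool :=
  (0 < v.1 <= n)%N && (0 < v.2 <= n)%N.

Definition rightward (e : edge) : bool :=
  (e.2.1 == e.1.1) && (e.2.2 == e.1.2.+1 :> nat).
Definition leftward (e : edge) : bool :=
  (e.2.1 == e.1.1) && (e.1.2 == e.2.2.+1 :> nat).
Definition downward (e : edge) : bool :=
  (e.2.2 == e.1.2) && (e.2.1 == e.1.1.+1 :> nat).
Definition upward (e : edge) : bool :=
  (e.2.2 == e.1.2) && (e.1.1 == e.2.1.+1 :> nat).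

Definition horizontal (e : edge) : bool := rightward e || leftward e.
Definition vertical (e : edge) : bool := downward e || upward e.

Definition complete_flow_grid : grid :=
  [set e : edge | internal e.1 && (horizontal e || vertical e)]%SET.

Definition incident (G : grid) (v : vertex) : {set edge} :=
  [set e in G | (e.1 == v) || (e.2 == v)]%SET.

Definition same_direction (H : {set edge}) : bool :=
  [|| [forall e in H, rightward e], [forall e in H, leftward e],
      [forall e in H, downward e] | [forall e in H, upward e]].

Definition two_parallel (H : {set edge}) : bool :=
  (#|H| == 2%N) && same_direction H.

Definition simple_flow_grid (G : grid) : bool :=
  (G \subset complete_flow_grid) &&
  [forall v : vertex, internal v ==>
     (#|incident G v| == 4%N) &&
     [|| [forall e in incident G v, e.2 == v],
         [forall e in incident G v, e.1 == v]
       | two_parallel [set e in incident G v | horizontal e]%SET &&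
         two_parallel [set e in incident G v | vertical e]%SET]].

Definition elementary_flow_grid (G : grid) : Prop :=
  exists2 X : {set grid}, {in X, forall S, simple_flow_grid S}
                        & G = (\bigcup_(S in X) S)%SET.

Definition double_directed (G : grid) (v w : vertex) : bool :=
  ((v, w) \in G) && ((w, v) \in G).

(* A cycle of length at least 3 in the undirected graph of double directed
   edges, represented by the symmetric closure of its edge set so that the base
   point and the direction of travel are forgotten. *)
Definition cycle_edges (c : seq vertex) : {set edge} :=
  [set e : edge | (e.1 \in c) && (e.2 == next c e.1)
               || (e.2 \in c) && (e.1 == next c e.2)]%SET.

Definition double_directed_cycle (G : grid) (E : {set edge}) : Prop :=
  exists c : seq vertex,
    [/\ (2 < size c)%N, ucycle (double_directed G) c & E = cycle_edges c].

(* The cell (i, j) is the unit square whose corners are the internal vertices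
   (i+1, j+1), (i+1, j+2), (i+2, j+1), (i+2, j+2). *)
Definition cell : finType := ('I_n.-1 * 'I_n.-1)%type.

Definition vtx (i j : nat) : vertex := (inord i, inord j).

Definition sides (c : cell) : {set edge} :=
  let tl := vtx c.1.+1 c.2.+1 in let tr := vtx c.1.+1 c.2.+2 in
  let bl := vtx c.1.+2 c.2.+1 in let br := vtx c.1.+2 c.2.+2 in
  [set (tl, tr); (bl, br); (tl, bl); (tr, br)]%SET.

(* Number of cells of S having s as a side: a segment is on the boundary of S
   when this is 1, and in its interior when this is 2. *)
Definition side_count (S : {set cell}) (s : edge) : nat :=
  #|[set c in S | s \in sides c]%SET|.

Definition cell_adj (S : {set cell}) : rel cell :=
  fun c d => [&& c \in S, d \in S & sides c :&: sides d != finset.set0]%SET.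

Definition cell_connected (S : {set cell}) : bool :=
  (S != finset.set0) && [forall c in S, forall d in S, connect (cell_adj S) c d].

Definition doubly_directed_region (G : grid) (S : {set cell}) : bool :=
  [&& cell_connected S,
      [forall s : edge, (side_count S s == 1%N) ==> double_directed G s.1 s.2]
    & [forall s : edge, (side_count S s == 2%N) ==> ~~ double_directed G s.1 s.2]].

Definition num_regions (G : grid) : nat :=
  #|[set S : {set cell} | doubly_directed_region G S]%SET|.

Section FromMatrices.
Variable R : realType.

(* Sum of the row or column of A from the border opposite to the head of e up
   to and including A i j, where the tail of e is the vertex of the entry
   (i, j). *)
Definition partial_sum (A : 'M[R]_n) (i j : 'I_n) (e : edge) : R :=
  if rightward e then \sum_(k < n | (k <= j)%N) A i k
  else if leftward e then \sum_(k < n | (j <= k)%N) A i k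
  else if downward e then \sum_(k < n | (k <= i)%N) A k j
  else \sum_(k < n | (i <= k)%N) A k j.

Definition flow_grid_of (A : 'M[R]_n) : grid :=
  [set e in complete_flow_grid |
     [exists i : 'I_n, exists j : 'I_n,
        (e.1 == vtx i.+1 j.+1) && (partial_sum A i j e == 1)]]%SET.

Definition flow_grid_of_face (F : set 'M[R]_n) : grid :=
  [set e : edge | `[< exists2 A, is_vertex F A & e \in flow_grid_of A >]]%SET.

End FromMatrices.
End FlowGrids.

(* Main.v *)
Require Import Defs.
From HB Require Import structures.
From mathcomp Require Import all_boot all_order all_algebra.
From mathcomp Require Import boolp classical_sets reals.
From mathcomp Require Import zify ring lra.

(** An alternating sign matrix is encoded by its corner sums, one free value per
    cell of the grid.  The orientation of a segment of the flow grid is the 0/1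
    difference of the corner sums on its two sides, so across a segment that is
    not double directed in [g(F)] this difference is constant on the face [F].
    The directions of [F] are therefore functions on the cells that vanish
    outside the grid and are constant on the components left when the double
    directed edges are removed, i.e. combinations of indicators of regions.
    Conversely, adding the indicator of a region to the corner sums of a sum of
    [m] vertices of [F] that realise all edges of [g(F)] keeps all differences in
    [[0, m]]; rounding (Hermite's identity) writes the result as a sum of [m]
    alternating sign matrices of [F], so every such indicator is a direction.
    The same rounding shows that [F] contains every alternating sign matrix whose
    flow grid lies in [g(F)].

    The jumps of a function on the cells form a circulation on the grid, and
    every circulation arises so.  Circulations supported on double directed
    edges are thus spanned by the regions, while they are also generated by
    cycles: there is one region if and only if there is one cycle. *)

Set Implicit Arguments.
Unset Strict Implicit.
Unset Printing Implicit Defensive.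

Import Order.TTheory GRing.Theory Num.Theory.

(** * Corner sums of alternating sign matrices *)

(** A component of cells left after cutting along the double directed segments need not be a region.
    It may reach the border, beyond which every direction vanishes, or a double directed segment
    might have that same component on both sides. The second case cannot occur in [g(F)]: the two
    orientations of such a segment come from two alternating sign matrices of the face, whose
    difference jumps there, whereas a direction is constant on a component.

    Sums of several matrices are needed because a single one has no room for an indicator: its
    differences are 0 or 1, and a change by 1 in the wrong sense leaves this range. In a sum that
    uses both orientations of a double directed segment, the difference across it lies strictly
    between 0 and [m], so a change by 1 in either sense is harmless. Hermite's identity is the right
    way to split the perturbed sum: its summands are monotone in the corner sum and grow by exactly
    1 when the corner sum grows by [m], so boundary values and extremal differences survive in each
    of them. *)

Section Heights.
Variable n : nat.
Implicit Types h H : nat -> nat -> nat.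

(* For [N = 1] these are the corner-sum functions of the alternating sign
   matrices; in general, the sums of [N] of them. *)
Record height (N : nat) H : Prop := Height {
  height0l : forall j, H 0 j = 0;
  height0r : forall i, H i 0 = 0;
  heightnl : forall j, j <= n -> H n j = N * j;
  heightnr : forall i, i <= n -> H i n = N * i;
  height_down : forall i j, i < n -> j <= n -> H i j <= H i.+1 j <= H i j + N;
  height_right : forall i j, i <= n -> j < n -> H i j <= H i j.+1 <= H i j + N }.

Lemma divn_step (N a b k : nat) : 0 < N -> a <= b <= a + N ->
  (a + k) %/ N <= (b + k) %/ N <= (a + k) %/ N + 1.
Proof.
move=> N0 /andP[ab ba]; rewrite leq_div2r ?leq_add2r //=.
have -> : (a + k) %/ N + 1 = (a + k + N) %/ N by rewrite (divnDr (a + k) (dvdnn N)) divnn N0.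
by apply: leq_div2r; lia.
Qed.

(* Hermite's identity *)
Lemma sum_divn_shift (N a : nat) : 0 < N -> \sum_(k < N) (a + k) %/ N = a.
Proof.
case: N => // N _; elim: a => [|a IHa].
  by rewrite big1 // => k _; rewrite divn_small // add0n.
move: IHa; rewrite big_ord_recl addn0 => IHa.
(* Passing from [a] to [a.+1] shifts the summands by one place: [a %/ N.+1] leaves and
   [(a + N.+1) %/ N.+1], which is larger by 1, enters. *)
rewrite big_ord_recr /=.
have -> : (a.+1 + N) %/ N.+1 = (a %/ N.+1).+1.
  by rewrite addSnnS divnDr // divnn addn1.
rewrite addnS -[in RHS]IHa addnC; congr (_ + _).+1.
by apply: eq_bigr => i _; rewrite /bump /= addSnnS.
Qed.

(** The shift [k < N] is too small to disturb the boundary values [N * j], and a step between 0 and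
    [N] becomes a step of 0 or 1 after division. *)
Lemma height_round N H k : 0 < N -> k < N -> height N H ->
  height 1 (fun i j => (H i j + k) %/ N).
Proof.
move=> N0 kN [H1 H2 H3 H4 H5 H6]; split=> [j|i|j jn|i ijn|i j ijn jn|i j ijn jn].
- by rewrite H1 divn_small.
- by rewrite H2 divn_small.
- by rewrite H3 // mulnC divnMDl // divn_small // mul1n addn0.
- by rewrite H4 // mulnC divnMDl // divn_small // mul1n addn0.
- exact/divn_step/H5.
- exact/divn_step/H6.
Qed.

Lemma height_sum (m : nat) (h : 'I_m -> nat -> nat -> nat) :
  (forall k, height 1 (h k)) -> height m (fun i j => \sum_k h k i j).
Proof.
move=> hh; split=> [j|i|j jn|i ijn|i j ijn jn|i j ijn jn].
- by rewrite big1 // => k _; case: (hh k).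
- by rewrite big1 // => k _; case: (hh k).
- rewrite (eq_bigr (fun=> j)) ?sum_nat_const ?card_ord // => k _.
  by case: (hh k) => _ _ /(_ j jn); rewrite mul1n.
- rewrite (eq_bigr (fun=> i)) ?sum_nat_const ?card_ord // => k _.
  by case: (hh k) => _ _ _ /(_ i ijn); rewrite mul1n.
- apply/andP; split; first by apply: leq_sum => k _; case: (hh k) => _ _ _ _ /(_ i j ijn jn)/andP[].
  rewrite -[X in _ <= _ + X]muln1 -[X in _ <= _ + X * 1]card_ord -sum_nat_const -big_split /=.
  by apply: leq_sum => k _; case: (hh k) => _ _ _ _ /(_ i j ijn jn)/andP[].
- apply/andP; split; first by apply: leq_sum => k _; case: (hh k) => _ _ _ _ _ /(_ i j ijn jn)/andP[].
  rewrite -[X in _ <= _ + X]muln1 -[X in _ <= _ + X * 1]card_ord -sum_nat_const -big_split /=.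
  by apply: leq_sum => k _; case: (hh k) => _ _ _ _ _ /(_ i j ijn jn)/andP[].
Qed.

End Heights.

Section HeightMatrices.
Variables (R : realType) (n : nat).
Local Open Scope ring_scope.

(** Inverse of taking corner sums, on functions that vanish in row 0 and column 0. It accepts real
    values, so that it is linear and applies to directions as well as to heights. *)
Definition mixed_diff (f : nat -> nat -> R) : 'M[R]_n :=
  \matrix_(i < n, j < n) (f i.+1 j.+1 - f i j.+1 - f i.+1 j + f i j).

Definition asm_of (h : nat -> nat -> nat) : 'M[R]_n :=
  mixed_diff (fun i j => (h i j)%:R).

Lemma big_ltnS (V : zmodType) (a : 'I_n -> V) (i : 'I_n) :
  \sum_(k < n | (k < i.+1)%N) a k = \sum_(k < n | (k < i)%N) a k + a i.
Proof.
rewrite (bigD1 i) //= addrC; congr (_ + _); apply: eq_bigl => k.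
by rewrite -val_eqE /= ltnS; lia.
Qed.

Lemma big_lt0 (V : zmodType) (a : 'I_n -> V) :
  \sum_(k < n | (k < 0)%N) a k = 0.
Proof. by rewrite big_pred0. Qed.

Lemma big_lt_all (V : zmodType) (a : 'I_n -> V) :
  \sum_(k < n | (k < n)%N) a k = \sum_k a k.
Proof. by apply: eq_bigl => k; rewrite ltn_ord. Qed.

Lemma big_lt_telescope (s : nat -> R) (a : 'I_n -> R) :
  (forall k : 'I_n, a k = s k.+1 - s k) -> forall m, (m <= n)%N ->
  \sum_(k < n | (k < m)%N) a k = s m - s 0%N.
Proof.
move=> as_; elim=> [|m IHm] mn; first by rewrite big_lt0 subrr.
have := big_ltnS a (Ordinal mn); rewrite /= => ->.
by rewrite IHm ?(ltnW mn) // as_ /=; ring.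
Qed.

Definition sign_entry (x : R) := [\/ x = 0, x = 1 | x = -1].

Definition alternating (a : 'I_n -> R) := forall j k : 'I_n, (j < k)%N ->
  a j != 0 -> a k != 0 -> (forall l : 'I_n, (j < l < k)%N -> a l = 0) ->
  a k = - a j.

(* All partial sums are 0 or the first nonzero entry, which must be the total
   sum 1. *)
Lemma alternating_partial_sum (a : 'I_n -> R) :
  (forall k, sign_entry (a k)) -> \sum_k a k = 1 -> alternating a ->
  forall m, (m <= n)%N ->
  \sum_(k < n | (k < m)%N) a k = 0 \/ \sum_(k < n | (k < m)%N) a k = 1.
Proof.
move=> sa s1 alta.
have [k0 ak0|a0] := pickP (fun k => a k != 0); last first.
  move: s1; rewrite big1 => [/esym/eqP|k _]; first by rewrite oner_eq0.
  by apply/eqP; have := a0 k; move/negbFE.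
case: (@arg_minnP _ k0 (fun k => a k != 0) (fun k : 'I_n => val k) ak0) => f af fmin.
have a0 (k : 'I_n) : (k < f)%N -> a k = 0.
  by move=> kf; apply/eqP/negP => /negP /fmin; rewrite leqNgt kf.
(* The last nonzero entry [a l] before position [m] decides the partial sum: alternation makes it
   [a f] or [- a f]. *)
have inv m : (f < m)%N -> (m <= n)%N -> exists l : 'I_n,
   [/\ (l < m)%N, a l != 0, (forall k : 'I_n, (l < k < m)%N -> a k = 0) &
     (\sum_(k < n | (k < m)%N) a k = 0 /\ a l = - a f) \/
     (\sum_(k < n | (k < m)%N) a k = a f /\ a l = a f)].
  elim: m => // m IHm; rewrite ltnS leq_eqVlt => /orP[/eqP <- fn|fm mn].
    exists f; split=> //; first by move=> k; lia.
    by right; rewrite big_ltnS big1 ?add0r.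
  have [l [lm al lz sl]] := IHm fm (ltnW mn).
  have := big_ltnS a (Ordinal mn); rewrite /= => ->.
  have [am|am] := eqVneq (a (Ordinal mn)) 0.
    exists l; split=> //; [lia| |by rewrite am addr0].
    move=> k /andP[lk]; rewrite ltnS leq_eqVlt => /orP[/eqP km|km].
      by rewrite -[RHS]am; congr a; apply/val_inj.
    by apply: lz; rewrite lk.
  exists (Ordinal mn); split=> //; first by move=> k /=; lia.
  have -> : a (Ordinal mn) = - a l by apply: alta.
  by case: sl => -[-> ->]; [right|left]; rewrite ?opprK ?add0r ?subrr.
have af1 : a f = 1.
  have [l [_ _ _]] := inv n (ltn_ord f) (leqnn n).
  rewrite big_lt_all s1 => -[[/eqP]|[<- //]]; by rewrite oner_eq0.
move=> m mn; case: (leqP m f) => fm.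
  left; apply: big1 => k km; apply: a0; lia.
have [l [_ _ _]] := inv m fm mn.
by rewrite af1 => -[[]|[]]; [left|right].
Qed.

(** Partial sums are constant between consecutive nonzero entries. As they take only the values 0
    and 1, the second of these entries must undo the first. *)
Lemma partial_sum_alternating (s : nat -> R) (a : 'I_n -> R) :
  (forall k : 'I_n, a k = s k.+1 - s k) ->
  (forall m, (m <= n)%N -> s m = 0 \/ s m = 1) ->
  (forall k, sign_entry (a k)) /\ alternating a.
Proof.
move=> as_ s01; split=> [k|j k jk aj ak az].
  rewrite as_; case: (s01 k.+1 (ltn_ord k)) => ->;
  case: (s01 k (ltnW (ltn_ord k))) => ->; rewrite ?subrr ?subr0 ?sub0r;
  by [constructor 1|constructor 2|constructor 3].
have E m : (j < m <= k)%N -> s m = s j.+1.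
  elim: m => // m IHm /andP[]; rewrite ltnS leq_eqVlt => /orP[/eqP-> //|jm mk].
  rewrite -IHm ?jm ?(ltnW mk) //; apply/eqP; rewrite -subr_eq0; apply/eqP.
  have mn : (m < n)%N by apply: leq_trans mk (ltnW (ltn_ord k)).
  by rewrite -(as_ (Ordinal mn)) az //= jm mk.
move: aj ak; rewrite !as_ (E k) ?jk ?leqnn //.
case: (s01 j.+1 (ltn_ord j)) => ->; case: (s01 k.+1 (ltn_ord k)) => ->;
case: (s01 j (ltnW (ltn_ord j))) => ->;
by rewrite ?subrr ?eqxx // ?subr0 ?sub0r ?opprK.
Qed.

Lemma height1_diff (a b : nat) : (a <= b <= a + 1)%N ->
  (b%:R - a%:R : R) = 0 \/ (b%:R - a%:R : R) = 1.
Proof.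
move=> ab; have [->|->] : b = a \/ b = a.+1 by lia.
  by left; rewrite subrr.
by right; rewrite -addn1 natrD addrC addKr.
Qed.

Lemma asm_of_rowsum h : height n 1 h -> forall (i : 'I_n) j, (j <= n)%N ->
  \sum_(k < n | (k < j)%N) asm_of h i k = (h i.+1 j)%:R - (h i j)%:R.
Proof.
move=> [_ h0 _ _ _ _] i j jn.
rewrite (@big_lt_telescope (fun k => (h i.+1 k)%:R - (h i k)%:R)) ?h0 ?subrr ?subr0 //.
by move=> k; rewrite mxE; ring.
Qed.

Lemma asm_of_colsum h : height n 1 h -> forall (j : 'I_n) i, (i <= n)%N ->
  \sum_(k < n | (k < i)%N) asm_of h k j = (h i j.+1)%:R - (h i j)%:R.
Proof.
move=> [h0 _ _ _ _ _] j i jn.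
rewrite (@big_lt_telescope (fun k => (h k j.+1)%:R - (h k j)%:R)) ?h0 ?subrr ?subr0 //.
by move=> k; rewrite mxE; ring.
Qed.

Lemma asm_of_ASM h : height n 1 h -> is_ASM (asm_of h).
Proof.
move=> hh; have [h0 h1 h2 h3 h4 h5] := hh.
have rowP (i : 'I_n) := @partial_sum_alternating (fun k => (h i.+1 k)%:R - (h i k)%:R)
   (asm_of h i).
have colP (j : 'I_n) := @partial_sum_alternating (fun k => (h k j.+1)%:R - (h k j)%:R)
   (fun i => asm_of h i j).
split.
- move=> i j; apply: (proj1 (rowP _ _ _)) => [k|m mn]; first by rewrite mxE; ring.
  exact/height1_diff/h4.
- move=> i; rewrite -big_lt_all asm_of_rowsum // !h3 ?(ltnW (ltn_ord i)) //.
  by rewrite !mul1n -addn1 natrD addrC addKr.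
- move=> j; rewrite -big_lt_all asm_of_colsum // !h2 ?(ltnW (ltn_ord j)) //.
  by rewrite !mul1n -addn1 natrD addrC addKr.
- move=> i; apply: (proj2 (rowP _ _ _)) => [k|m mn]; first by rewrite mxE; ring.
  exact/height1_diff/h4.
- move=> j; apply: (proj2 (colP _ _ _)) => [k|m mn]; first by rewrite mxE; ring.
  exact/height1_diff/h5.
Qed.

Lemma ASM_height A : is_ASM A -> exists2 h, height n 1 h & A = asm_of h.
Proof.
move=> [As rA cA altr altc].
pose rp (k : 'I_n) j := \sum_(l < n | (l < j)%N) A k l.
have rp01 k j : (j <= n)%N -> rp k j = 0 \/ rp k j = 1.
  by apply: alternating_partial_sum; [exact: As|exact: rA|exact: altr].
have rpE k j : (j <= n)%N -> (rp k j == 1)%:R = rp k j.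
  by case/(rp01 k) => ->; rewrite ?eqxx // eq_sym oner_eq0.
have cp01 (l : 'I_n) i : (i <= n)%N ->
    \sum_(k < n | (k < i)%N) A k l = 0 \/ \sum_(k < n | (k < i)%N) A k l = 1.
  by apply: (@alternating_partial_sum (fun k => A k l)); [move=> k; exact: As|exact: cA|exact: altc].
(* Row partial sums are 0 or 1, so counting the rows where they equal 1 yields the corner sum as a
   natural number. *)
pose h i j := (\sum_(k < n | (k < i)%N) (rp k j == 1%R))%N.
have hE i j : (j <= n)%N -> (h i j)%:R = \sum_(k < n | (k < i)%N) rp k j.
  by move=> jn; rewrite natr_sum; apply: eq_bigr => k _; rewrite rpE.
have inj_nat (a b : nat) : a%:R = b%:R :> R -> a = b by move/eqP; rewrite eqr_nat => /eqP.
have rp_rec i (j : 'I_n) : rp i j.+1 = rp i j + A i j by exact: big_ltnS.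
have h_rec (i : 'I_n) j : h i.+1 j = (h i j + (rp i j == 1%R))%N.
  rewrite /h (bigD1 i) //= addnC; congr (_ + _)%N; apply: eq_bigl => k.
  by rewrite -val_eqE /= ltnS; lia.
exists h; last first.
  apply/matrixP => i j; rewrite mxE !h_rec !natrD.
  by rewrite !rpE ?(ltnW (ltn_ord j)) ?ltn_ord // rp_rec; ring.
split.
- by move=> j; rewrite /h big_pred0.
- move=> i; apply: inj_nat; rewrite hE // big1 // => k _; exact: big_lt0.
- move=> j jn; apply: inj_nat; rewrite hE // big_lt_all exchange_big /=.
  under eq_bigr do rewrite cA.
  have := @big_lt_telescope (fun k => k%:R) (fun=> 1) _ j jn.
  by rewrite /= subr0 mul1n; apply=> k; rewrite -addn1 natrD addrC addKr.
- move=> i jn; apply: inj_nat; rewrite hE //.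
  under eq_bigr do rewrite /rp big_lt_all rA.
  have := @big_lt_telescope (fun k => k%:R) (fun=> 1) _ i jn.
  by rewrite /= subr0 mul1n; apply=> k; rewrite -addn1 natrD addrC addKr.
- by move=> i j i_n jn; rewrite (h_rec (Ordinal i_n)) /=; case: (_ == _); lia.
- move=> i j i_n jn.
  have : (h i j.+1)%:R - (h i j)%:R = \sum_(k < n | (k < i)%N) A k (Ordinal jn).
    rewrite !hE ?(ltnW jn) // -sumrB; apply: eq_bigr => k _.
    by rewrite (rp_rec k (Ordinal jn)) /=; ring.
  move=> E; case: (cp01 (Ordinal jn) i i_n) => cE; move: E; rewrite cE => /eqP.
    by rewrite subr_eq add0r eqr_nat => /eqP ->; lia.
  by rewrite subr_eq nat1r eqr_nat => /eqP ->; lia.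
Qed.

End HeightMatrices.

(** * Flow grids of height functions *)

Section GridOfHeight.
Variable n : nat.
Implicit Types h : nat -> nat -> nat.
Local Notation vtx := (vtx n).

Lemma vtx_val (v : vertex n) : vtx v.1 v.2 = v.
Proof. by case: v => a b; rewrite /Defs.vtx !inord_val. Qed.

Lemma eq_vtx i j i' j' : i <= n.+1 -> j <= n.+1 -> i' <= n.+1 -> j' <= n.+1 ->
  (vtx i j == vtx i' j') = (i == i') && (j == j').
Proof. by move=> ? ? ? ?; rewrite xpair_eqE -!val_eqE /= !inordK. Qed.

Lemma internal_vtx i j : i <= n.+1 -> j <= n.+1 ->
  internal (vtx i j) = (0 < i <= n) && (0 < j <= n).
Proof. by move=> ? ?; rewrite /internal /= !inordK. Qed.

Section Directions.
Variables (i j i' j' : nat).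
Hypotheses (hi : i <= n.+1) (hj : j <= n.+1) (hi' : i' <= n.+1) (hj' : j' <= n.+1).

Lemma rightward_vtx :
  rightward (vtx i j, vtx i' j') = (i' == i) && (j' == j.+1).
Proof. by rewrite /rightward -val_eqE /= !inordK. Qed.

Lemma leftward_vtx :
  leftward (vtx i j, vtx i' j') = (i' == i) && (j == j'.+1).
Proof. by rewrite /leftward -val_eqE /= !inordK. Qed.

Lemma downward_vtx :
  downward (vtx i j, vtx i' j') = (j' == j) && (i' == i.+1).
Proof. by rewrite /downward -val_eqE /= !inordK. Qed.

Lemma upward_vtx :
  upward (vtx i j, vtx i' j') = (j' == j) && (i == i'.+1).
Proof. by rewrite /upward -val_eqE /= !inordK. Qed.

End Directions.

Definition dir_vtx := (rightward_vtx, leftward_vtx, downward_vtx, upward_vtx).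

(** The four index ranges differ because only the tail of an edge has to be internal; the head may
    lie on the boundary. *)
Lemma complete_edge_ind (P : edge n -> Prop) :
  (forall i j, i < n -> 0 < j <= n -> P (vtx i.+1 j, vtx i.+1 j.+1)) ->
  (forall i j, i < n -> j < n -> P (vtx i.+1 j.+1, vtx i.+1 j)) ->
  (forall i j, 0 < i <= n -> j < n -> P (vtx i j.+1, vtx i.+1 j.+1)) ->
  (forall i j, i < n -> j < n -> P (vtx i.+1 j.+1, vtx i j.+1)) ->
  forall e, e \in complete_flow_grid n -> P e.
Proof.
move=> PR PL PD PU [v w]; rewrite inE /= /internal => /andP[/andP[/andP[v1 v1n] /andP[v2 v2n]]].
rewrite -(vtx_val v) -(vtx_val w).
have := ltn_ord w.1; have := ltn_ord w.2.
move: v1 v1n v2 v2n; move: (nat_of_ord v.1) (nat_of_ord v.2) (nat_of_ord w.1) (nat_of_ord w.2).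
move=> a b c d a0 an b0 bn dn cn.
rewrite /horizontal /vertical !dir_vtx; try lia.
case/orP => /orP[] /andP[/eqP E1 /eqP E2]; subst.
- case: a {cn} a0 an => // a _ an; apply: PR; lia.
- case: a {cn} a0 an => // a _ an; apply: PL; lia.
- case: b {dn} b0 bn => // b _ bn; apply: PD; lia.
- case: b {dn} b0 bn => // b _ bn; apply: PU; lia.
Qed.

Lemma mem_complete i j i' j' :
  i <= n.+1 -> j <= n.+1 -> i' <= n.+1 -> j' <= n.+1 ->
  ((vtx i j, vtx i' j') \in complete_flow_grid n) =
  ((0 < i <= n) && (0 < j <= n)) &&
  ((i' == i) && ((j' == j.+1) || (j == j'.+1)) ||
   (j' == j) && ((i' == i.+1) || (i == i'.+1))).
Proof.
move=> ? ? ? ?; rewrite inE /= internal_vtx //; congr andb.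
by rewrite /horizontal /vertical !dir_vtx // -!andb_orr.
Qed.

(** The horizontal segment from [(i.+1, j)] to [(i.+1, j.+1)] separates the corner sums [h i j] and
    [h i.+1 j], whose difference is the sum of the first [j] entries of that row. It points
    rightward when the difference is 1 and leftward when it is 0. Vertical segments behave in the
    same way with column sums. *)
Definition grid_of_height h : grid n :=
  [set e in complete_flow_grid n |
    [|| rightward e && (h e.1.1.-1 e.1.2 < h e.1.1 e.1.2),
        leftward e && (h e.2.1.-1 e.2.2 == h e.2.1 e.2.2),
        downward e && (h e.1.1 e.1.2.-1 < h e.1.1 e.1.2)
      | upward e && (h e.2.1 e.2.2.-1 == h e.2.1 e.2.2)]]%SET.

Lemma grid_of_height_complete h : grid_of_height h \subset complete_flow_grid n.
Proof. by apply/fintype.subsetP => e; rewrite inE => /andP[]. Qed.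

(** The range includes [j = 0], where the tail is a boundary vertex: the edge is absent and both
    corner sums vanish. In the leftward case the corresponding extreme is [j = n], where the corner
    sums are [i] and [i.+1]. *)
Lemma mem_grid_right h i j : height n 1 h -> i < n -> j <= n ->
  ((vtx i.+1 j, vtx i.+1 j.+1) \in grid_of_height h) = (h i j < h i.+1 j).
Proof.
move=> [h1 h2 h3 h4 h5 h6] i_n jn.
rewrite inE mem_complete ?dir_vtx /= ?inordK /=; try lia.
by case: j jn => [|j] jn; rewrite ?h2; lia.
Qed.

Lemma mem_grid_left h i j : height n 1 h -> i < n -> j <= n ->
  ((vtx i.+1 j.+1, vtx i.+1 j) \in grid_of_height h) = (h i j == h i.+1 j).
Proof.
move=> [h1 h2 h3 h4 h5 h6] i_n jn.
rewrite inE mem_complete ?dir_vtx /= ?inordK /=; try lia.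
have := h4 i; have := h4 i.+1; case: (ltngtP j n) jn => // [jn|->] _; lia.
Qed.

Lemma mem_grid_down h i j : height n 1 h -> i <= n -> j < n ->
  ((vtx i j.+1, vtx i.+1 j.+1) \in grid_of_height h) = (h i j < h i j.+1).
Proof.
move=> [h1 h2 h3 h4 h5 h6] i_n jn.
rewrite inE mem_complete ?dir_vtx /= ?inordK /=; try lia.
by case: i i_n => [|i] i_n; rewrite ?h1; lia.
Qed.

Lemma mem_grid_up h i j : height n 1 h -> i <= n -> j < n ->
  ((vtx i.+1 j.+1, vtx i j.+1) \in grid_of_height h) = (h i j == h i j.+1).
Proof.
move=> [h1 h2 h3 h4 h5 h6] i_n jn.
rewrite inE mem_complete ?dir_vtx /= ?inordK /=; try lia.
have := h3 j; have := h3 j.+1; case: (ltngtP i n) i_n => // [i_n|->] _; lia.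
Qed.

Definition mem_grid := (mem_grid_right, mem_grid_left, mem_grid_down, mem_grid_up).

Lemma height_eqP h h' : height n 1 h -> height n 1 h' ->
  (forall i j, i < n -> 0 < j < n -> (h i j < h i.+1 j) = (h' i j < h' i.+1 j)) ->
  forall i j, i <= n -> j <= n -> h i j = h' i j.
Proof.
move=> [h1 h2 h3 h4 h5 h6] [h1' h2' h3' h4' h5' h6'] E; elim=> [|i IHi] j i_n jn.
  by rewrite h1 h1'.
have [->|j0] := posnP j; first by rewrite h2 h2'.
case: (ltngtP j n) jn => // [jn _|-> _]; last by rewrite h4 // h4'.
have := IHi j (ltnW i_n) (ltnW jn); have := E i j i_n; rewrite j0 jn => /(_ isT).
have := h5 i j i_n (ltnW jn); have := h5' i j i_n (ltnW jn); lia.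
Qed.

(** A segment with internal ends has exactly one orientation in each of the two grids, so inclusion
    already forces equal orientations, and the corner sums are then recovered row by row. *)
Lemma grid_of_height_inj h h' : height n 1 h -> height n 1 h' ->
  grid_of_height h \subset grid_of_height h' ->
  forall i j, i <= n -> j <= n -> h i j = h' i j.
Proof.
move=> hh hh' /fintype.subsetP sub; apply: height_eqP => // i j i_n /andP[j0 jn].
have := sub (vtx i.+1 j, vtx i.+1 j.+1); have := sub (vtx i.+1 j.+1, vtx i.+1 j).
rewrite !mem_grid ?(ltnW jn) //.
have := height_down hh i_n (ltnW jn); have := height_down hh' i_n (ltnW jn); lia.
Qed.

End GridOfHeight.

Section FlowGridOfASM.
Variables (R : realType) (n : nat).
Local Open Scope ring_scope.
Local Notation vtx := (vtx n).

Lemma exists_vtx (a b : 'I_n) (P : 'I_n -> 'I_n -> bool) :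
  [exists i : 'I_n, exists j : 'I_n,
     (vtx a.+1 b.+1 == vtx i.+1 j.+1) && P i j] = P a b.
Proof.
have Ev (i j : 'I_n) : (vtx a.+1 b.+1 == vtx i.+1 j.+1) = (a == i) && (b == j).
  by rewrite eq_vtx ?(ltnW (ltn_ord _)) // ltnW // ltnS ltn_ord.
apply/existsP/idP => [[i /existsP[j]]|Pab].
  by rewrite Ev => /andP[/andP[/eqP <- /eqP <-]].
by exists a; apply/existsP; exists b; rewrite Ev !eqxx.
Qed.

Lemma big_ge (a : 'I_n -> R) (j : nat) :
  \sum_(k < n | (j <= k)%N) a k = \sum_k a k - \sum_(k < n | (k < j)%N) a k.
Proof.
rewrite [in X in X - _](bigID (fun k : 'I_n => (k < j)%N)) /= addrAC subrr add0r.
by apply: eq_bigl => k; rewrite -leqNgt.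
Qed.

Lemma natr_sub_eq1 (a b : nat) : (a <= b <= a + 1)%N ->
  (b%:R - a%:R == 1 :> R) = (a < b)%N.
Proof.
move=> ab; rewrite subr_eq nat1r eqr_nat; lia.
Qed.

Lemma natr_sub_eq0 (a b : nat) : (a <= b <= a + 1)%N ->
  (1 - (b%:R - a%:R) == 1 :> R) = (a == b)%N.
Proof.
move=> ab; rewrite subr_eq addrC -subr_eq subrr eq_sym subr_eq0 eqr_nat.
by rewrite eq_sym.
Qed.

(** A partial sum taken from the right or bottom border is 1 minus the complementary sum from the
    left or top. It equals 1 exactly when the corner sums do not jump. *)
Lemma flow_grid_of_asm h : height n 1 h ->
  flow_grid_of (asm_of R n h) = grid_of_height n h.
Proof.
move=> hh; have [_ row1 col1 _ _] := asm_of_ASM R hh.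
apply/setP => e; rewrite inE.
have [eC|eC] /= := boolP (e \in complete_flow_grid n); last first.
  by apply/esym/negP => /(fintype.subsetP (grid_of_height_complete n h)); apply/negP.
apply: (@complete_edge_ind n (fun e => [exists i : 'I_n, exists j : 'I_n,
   (e.1 == vtx i.+1 j.+1) && (partial_sum (asm_of R n h) i j e == 1)] =
   (e \in grid_of_height n h))) eC => i j.
- case: j => // j i_n jn; rewrite (exists_vtx (Ordinal i_n) (Ordinal jn)).
  rewrite mem_grid // /partial_sum !dir_vtx; try lia.
  rewrite !eqxx /=.
  under eq_bigl do rewrite -ltnS.
  by rewrite asm_of_rowsum // natr_sub_eq1 ?(height_down hh).
- move=> i_n jn; rewrite (exists_vtx (Ordinal i_n) (Ordinal jn)).
  rewrite mem_grid ?(ltnW jn) // /partial_sum !dir_vtx; try lia.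
  rewrite !eqxx /= ifF; last by lia.
  by rewrite big_ge row1 asm_of_rowsum ?(ltnW jn) // natr_sub_eq0 ?(height_down hh) ?(ltnW jn).
- case: i => // i i_n jn; rewrite (exists_vtx (Ordinal i_n) (Ordinal jn)).
  rewrite mem_grid // /partial_sum !dir_vtx; try lia.
  rewrite !eqxx /= ifF ?ifF; try lia.
  under eq_bigl do rewrite -ltnS.
  by rewrite asm_of_colsum // natr_sub_eq1 ?(height_right hh).
- move=> i_n jn; rewrite (exists_vtx (Ordinal i_n) (Ordinal jn)).
  rewrite mem_grid ?(ltnW i_n) // /partial_sum !dir_vtx; try lia.
  rewrite !eqxx /= !ifF; try lia.
  by rewrite big_ge col1 asm_of_colsum ?(ltnW i_n) // natr_sub_eq0 ?(height_right hh) ?(ltnW i_n).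
Qed.

End FlowGridOfASM.

(** * Simple flow grids as grids of height functions *)

Section SimpleGrids.
Variable n : nat.
Local Notation vtx := (vtx n).

Lemma eq_edge (v w v' w' : vertex n) :
  ((v, w) == (v', w') :> edge n) = (v == v') && (w == w').
Proof. exact: xpair_eqE. Qed.

Lemma internalP (v : vertex n) : internal v ->
  exists i j, [/\ i < n, j < n & v = vtx i.+1 j.+1].
Proof.
move=> /andP[/andP[v1 v1n] /andP[v2 v2n]]; exists v.1.-1, v.2.-1.
by rewrite !prednK // vtx_val.
Qed.

Lemma card_mem_seq (T : finType) (H : {set T}) (s : seq T) :
  uniq s -> H =i s -> #|H| = size s.
Proof. by move=> us Hs; rewrite (eq_card Hs); apply/card_uniqP. Qed.

Lemma forall_mem_seq (T : finType) (H : {set T}) (s : seq T) (P : pred T) :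
  H =i s -> [forall e in H, P e] = all P s.
Proof.
move=> Hs; apply/'forall_implyP/allP => HP e; first by rewrite -Hs; exact: HP.
by rewrite Hs; exact: HP.
Qed.

(* The arguments record, for each of two opposite neighbours, whether the
   outgoing and the incoming edge are present. *)
Definition parallel_at (o1 i1 o2 i2 : bool) :=
  (o1 + i1 + o2 + i2 == 2) && (~~ (i1 || o2) || ~~ (o1 || i2)).

Definition simple_at (ro ri lo li dO di uo ui : bool) :=
  (ro + ri + lo + li + dO + di + uo + ui == 4) &&
  [|| ~~ [|| ro, lo, dO | uo], ~~ [|| ri, li, di | ui]
    | parallel_at ro ri lo li && parallel_at dO di uo ui].

(** The local rule splits into two facts: each of the four segments carries exactly one orientation,
    and the 0/1 differences agree along the two ways around the vertex. The second fact is what lets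
    them come from a height function. *)
Lemma simple_atE ro ri lo li dO di uo ui :
  simple_at ro ri lo li dO di uo ui =
  [&& ri == ~~ ro, lo == ~~ li, di == ~~ dO, uo == ~~ ui & ro + ui == dO + li].
Proof. by case: ro; case: ri; case: lo; case: li; case: dO; case: di; case: uo; case: ui. Qed.

Definition edges_at i j : seq (edge n) :=
  let v := vtx i.+1 j.+1 in
  [:: (v, vtx i.+1 j.+2); (vtx i.+1 j.+2, v);
      (v, vtx i.+1 j); (vtx i.+1 j, v);
      (v, vtx i.+2 j.+1); (vtx i.+2 j.+1, v);
      (v, vtx i j.+1); (vtx i j.+1, v)].

Lemma mem_incident (G : grid n) i j : i < n -> j < n ->
  G \subset complete_flow_grid n ->
  incident G (vtx i.+1 j.+1) =i [seq e <- edges_at i j | e \in G].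
Proof.
move=> i_n jn /fintype.subsetP GC e; rewrite inE mem_filter.
have [eG|//] /= := boolP (e \in G); apply/idP/idP; last first.
  by rewrite !inE; do 7?[case/orP]; move/eqP->; rewrite eqxx ?orbT.
apply: (@complete_edge_ind n (fun e => (e.1 == vtx i.+1 j.+1) ||
  (e.2 == vtx i.+1 j.+1) -> e \in edges_at i j)) (GC _ eG) => a b ha hb /=;
case/orP; rewrite eq_vtx; try lia; case/andP=> /eqP E1 /eqP E2; move: ha hb;
by case: E1 E2 => [] -> [] -> _ _; rewrite !inE !eqxx ?orbT.
Qed.

Lemma eqn_SF k : ((k == k.+1) = false) * ((k.+1 == k) = false) *
  ((k == k.+2) = false) * ((k.+2 == k) = false).
Proof. by do ![split]; lia. Qed.

Lemma uniq_edges_at i j : i < n -> j < n -> uniq (edges_at i j).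
Proof.
move=> i_n jn.
have [i0 i1 j0 j1] : [/\ i <= n.+1, i.+1 <= n.+1, j <= n.+1 & j.+1 <= n.+1] by split; lia.
by rewrite /= !inE !eq_edge !eq_vtx // !eqSS !eqn_SF !eqxx.
Qed.

(** Only the eight edges of [edges_at] can meet the vertex, so the condition is a Boolean function
    of their memberships in [G] and is settled by exhaustion. *)
Lemma simple_vertexE (G : grid n) i j : i < n -> j < n ->
  G \subset complete_flow_grid n ->
  let v := vtx i.+1 j.+1 in
  (#|incident G v| == 4%N) &&
  [|| [forall e in incident G v, e.2 == v],
      [forall e in incident G v, e.1 == v]
    | two_parallel [set e in incident G v | horizontal e]%SET &&
      two_parallel [set e in incident G v | vertical e]%SET] =
  simple_at ((v, vtx i.+1 j.+2) \in G) ((vtx i.+1 j.+2, v) \in G)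
            ((v, vtx i.+1 j) \in G) ((vtx i.+1 j, v) \in G)
            ((v, vtx i.+2 j.+1) \in G) ((vtx i.+2 j.+1, v) \in G)
            ((v, vtx i j.+1) \in G) ((vtx i j.+1, v) \in G).
Proof.
move=> i_n jn GC v; have IG := mem_incident i_n jn GC.
have us := filter_uniq (mem G) (uniq_edges_at i_n jn).
have IQ (Q : pred (edge n)) : [set e in incident G v | Q e]%SET =i
    [seq e <- [seq e <- edges_at i j | e \in G] | Q e].
  by move=> e; rewrite inE mem_filter IG andbC.
have uQ Q := filter_uniq Q us.
rewrite (card_mem_seq us IG) !(forall_mem_seq _ IG) /two_parallel /same_direction.
rewrite !(card_mem_seq (uQ _) (IQ _)) !(forall_mem_seq _ (IQ _)).
rewrite !size_filter !all_filter !count_filter.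
have [i0 i1 j0 j1] : [/\ i <= n.+1, i.+1 <= n.+1, j <= n.+1 & j.+1 <= n.+1] by split; lia.
rewrite /edges_at -/v /= /horizontal /vertical /v !dir_vtx // ?eq_vtx // ?eqSS ?eqn_SF ?eqxx /=.
rewrite /simple_at /parallel_at.
by do 8![case: (_ \in G)].
Qed.

Lemma simple_grid_of_height h : height n 1 h -> simple_flow_grid (grid_of_height n h).
Proof.
move=> hh; rewrite /simple_flow_grid grid_of_height_complete /=.
apply/forallP => v; apply/implyP => /internalP[i [j [i_n jn ->]]].
rewrite simple_vertexE ?grid_of_height_complete // simple_atE !mem_grid //; try lia.
have := height_down hh i_n (ltnW jn); have := height_down hh i_n jn.
have := height_right hh (ltnW i_n) jn; have := height_right hh i_n jn.
lia.
Qed.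

(** The rightward edges are the vertical differences of the height and the downward edges its
    horizontal ones. The balance at each vertex makes them consistent, so summing [r] down a column
    also produces the differences [c]. *)
Lemma simple_grid_height (G : grid n) : simple_flow_grid G ->
  exists2 h, height n 1 h & G = grid_of_height n h.
Proof.
move=> /andP[GC /forallP GS].
pose r i j := (vtx i.+1 j, vtx i.+1 j.+1) \in G.
pose c i j := (vtx i j.+1, vtx i.+1 j.+1) \in G.
have loc i j : i < n -> j < n ->
  [/\ (vtx i.+1 j.+2, vtx i.+1 j.+1) \in G = ~~ r i j.+1,
      (vtx i.+1 j.+1, vtx i.+1 j) \in G = ~~ r i j,
      (vtx i.+2 j.+1, vtx i.+1 j.+1) \in G = ~~ c i.+1 j,
      (vtx i.+1 j.+1, vtx i j.+1) \in G = ~~ c i j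
    & r i j.+1 + c i j = c i.+1 j + r i j].
  move=> i_n jn; have := GS (vtx i.+1 j.+1); rewrite internal_vtx; try lia.
  rewrite simple_vertexE // simple_atE /= i_n jn /= => /and5P[/eqP-> /eqP-> /eqP-> /eqP-> /eqP E].
  by split.
have GCf e : e \notin complete_flow_grid n -> (e \in G) = false.
  by move=> eC; apply/negP => /(fintype.subsetP GC); apply/negP.
(* No edge of the complete flow grid leaves a boundary vertex, so border segments point outward.
   This gives all boundary values of [h]. *)
have r0 i : r i 0 = false by rewrite /r GCf // inE /internal /= (@inordK n.+1 0) //= ?andbF.
have c0 j : c 0 j = false by rewrite /c GCf // inE /internal /= (@inordK n.+1 0) //= ?andbF.
have rL i j : i < n -> j <= n -> (vtx i.+1 j.+1, vtx i.+1 j) \in G = ~~ r i j.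
  move=> i_n; rewrite leq_eqVlt => /orP[/eqP jn|jn]; last by case: (loc i j).
  by case: j jn => [?|j jn]; [lia|case: (loc i j) => //; lia].
have cU i j : i <= n -> j < n -> (vtx i.+1 j.+1, vtx i j.+1) \in G = ~~ c i j.
  rewrite leq_eqVlt => /orP[/eqP i_n|i_n] jn; last by case: (loc i j).
  by case: i i_n => [?|i i_n]; [lia|case: (loc i j) => //; lia].
have rn i : i < n -> r i n = true.
  move=> i_n; apply: negb_inj; rewrite -rL // GCf //.
  by rewrite mem_complete; lia.
have cn j : j < n -> c n j = true.
  move=> i_n; apply: negb_inj; rewrite -cU // GCf //.
  by rewrite mem_complete; lia.
pose h i j := \sum_(k < i) r k j.
have hr i j : h i.+1 j = h i j + r i j by rewrite /h big_ord_recr.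
have h0 j : h 0 j = 0 by rewrite /h big_ord0.
have hc i j : i <= n -> j < n -> h i j.+1 = h i j + c i j.
  elim: i => [|i IHi] i_n jn; first by rewrite !h0 c0.
  by rewrite !hr IHi // 1?ltnW //; case: (loc i j i_n jn) => *; lia.
have hh : height n 1 h.
  split=> //.
  - by move=> i; rewrite /h big1 // => k _; rewrite r0.
  - elim=> [|j IHj] jn; first by rewrite /h big1 // => k _; rewrite r0.
    by rewrite hc // IHj ?cn //; lia.
  - by elim=> [|i IHi] i_n; rewrite ?h0 // hr IHi ?rn //; lia.
  - by move=> i j i_n jn; rewrite hr; case: (r i j); lia.
  - by move=> i j i_n jn; rewrite hc //; case: (c i j); lia.
exists h => //; apply/setP => e.
have [eC|eC] := boolP (e \in complete_flow_grid n); last first.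
  by rewrite GCf //; apply/esym/negP => /(fintype.subsetP (grid_of_height_complete n h)); apply/negP.
apply: (@complete_edge_ind n (fun e => (e \in G) = (e \in grid_of_height n h))) eC => i j ijn jn.
- by rewrite mem_grid //; [rewrite hr -/(r i j); case: (r i j); lia|lia].
- by rewrite mem_grid ?rL ?(ltnW jn) // hr; case: (r i j); lia.
- by rewrite mem_grid //; [rewrite hc //; [rewrite -/(c i j); case: (c i j); lia|lia]|lia].
- by rewrite mem_grid ?cU ?(ltnW ijn) // hc ?(ltnW ijn) //; case: (c i j); lia.
Qed.

End SimpleGrids.

(** * Doubly directed regions *)

Section Indicators.
Variable n : nat.
Local Notation vtx := (vtx n).
Implicit Types (S : {set cell n}) (c : cell n).

(* The cell [c] carries the corner sum at [(c.1 + 1, c.2 + 1)]; the positions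
   outside [1 .. n-1] are those where all corner sums are fixed. *)
Definition at_pos c i j : bool := (c.1.+1 == i) && (c.2.+1 == j).

Definition inner i j : bool := (0 < i < n) && (0 < j < n).

Definition ind S i j : nat := \sum_(c in S) at_pos c i j.

Lemma inner_pos c : inner c.1.+1 c.2.+1.
Proof. by rewrite /inner; have := ltn_ord c.1; have := ltn_ord c.2; lia. Qed.

Lemma inner_cell i j : inner i j -> exists2 c : cell n, i = c.1.+1 & j = c.2.+1.
Proof.
move=> /andP[i0 j0]; have hi : i.-1 < n.-1 by lia.
have hj : j.-1 < n.-1 by lia.
by exists (Ordinal hi, Ordinal hj) => /=; rewrite prednK //; lia.
Qed.

Lemma at_posE (c d : cell n) : at_pos c d.1.+1 d.2.+1 = (c == d).
Proof. by case: c d => [a b] [a' b']; rewrite /at_pos /= !eqSS xpair_eqE. Qed.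

Lemma ind_cell S c : ind S c.1.+1 c.2.+1 = (c \in S).
Proof.
have [cS|cS] := boolP (c \in S).
  rewrite /ind (bigD1 c) //= at_posE eqxx big1 // => d /andP[_ dc].
  by rewrite at_posE (negbTE dc).
rewrite /ind big1 // => d dS; rewrite at_posE.
by case: eqVneq dS => // -> ; rewrite (negbTE cS).
Qed.

Lemma ind_outer S i j : ~~ inner i j -> ind S i j = 0.
Proof.
move=> ij; rewrite /ind big1 // => c _; apply/eqP; rewrite eqb0.
by apply: contra ij => /andP[/eqP <- /eqP <-]; exact: inner_pos.
Qed.

Lemma ind_le1 S i j : ind S i j <= 1.
Proof.
have [/inner_cell[c -> ->]|/ind_outer->//] := boolP (inner i j).
by rewrite ind_cell leq_b1.
Qed.

Lemma mem_sides_h c i j : i < n -> 0 < j < n ->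
  ((vtx i.+1 j, vtx i.+1 j.+1) \in sides c) = at_pos c i j || at_pos c i.+1 j.
Proof.
move=> i_n jn; have c1 := ltn_ord c.1; have c2 := ltn_ord c.2.
rewrite /at_pos !inE !eq_edge !eq_vtx; lia.
Qed.

Lemma mem_sides_v c i j : 0 < i < n -> j < n ->
  ((vtx i j.+1, vtx i.+1 j.+1) \in sides c) = at_pos c i j || at_pos c i j.+1.
Proof.
move=> i_n jn; have c1 := ltn_ord c.1; have c2 := ltn_ord c.2.
rewrite /at_pos !inE !eq_edge !eq_vtx; lia.
Qed.

Lemma side_ind (P : edge n -> Prop) :
  (forall i j, i < n -> 0 < j < n -> P (vtx i.+1 j, vtx i.+1 j.+1)) ->
  (forall i j, 0 < i < n -> j < n -> P (vtx i j.+1, vtx i.+1 j.+1)) ->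
  forall c s, s \in sides c -> P s.
Proof.
move=> Ph Pv c s; have := ltn_ord c.1; have := ltn_ord c.2 => c1 c2.
rewrite !inE => /orP[/orP[/orP[]|]|] /eqP ->;
  by [apply: Ph; lia|apply: Pv; lia].
Qed.

Lemma side_count_sum S s : side_count S s = \sum_(c in S) (s \in sides c).
Proof.
rewrite /side_count -sum1_card big_mkcond [RHS]big_mkcond; apply: eq_bigr => c _.
by rewrite !inE; case: (c \in S) => //; case: (s \in _).
Qed.

Lemma side_count_h S i j : i < n -> 0 < j < n ->
  side_count S (vtx i.+1 j, vtx i.+1 j.+1) = ind S i j + ind S i.+1 j.
Proof.
move=> i_n jn; rewrite side_count_sum /ind -big_split /=; apply: eq_bigr => c _.
rewrite mem_sides_h // /at_pos; lia.
Qed.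

Lemma side_count_v S i j : 0 < i < n -> j < n ->
  side_count S (vtx i j.+1, vtx i.+1 j.+1) = ind S i j + ind S i j.+1.
Proof.
move=> i_n jn; rewrite side_count_sum /ind -big_split /=; apply: eq_bigr => c _.
rewrite mem_sides_v // /at_pos; lia.
Qed.

End Indicators.

Section Regions.
Variables (R : realType) (n : nat) (G : grid n).
Local Notation vtx := (vtx n).
Implicit Types (S : {set cell n}) (c : cell n) (d : nat -> nat -> R).

Definition dd_h i j := double_directed G (vtx i.+1 j) (vtx i.+1 j.+1).
Definition dd_v i j := double_directed G (vtx i j.+1) (vtx i.+1 j.+1).

Lemma regionP S : doubly_directed_region G S <->
  [/\ cell_connected S,
      forall i j, i < n -> 0 < j < n ->
        (ind S i j + ind S i.+1 j = 1 -> dd_h i j) /\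
        (ind S i j + ind S i.+1 j = 2 -> ~~ dd_h i j)
    & forall i j, 0 < i < n -> j < n ->
        (ind S i j + ind S i j.+1 = 1 -> dd_v i j) /\
        (ind S i j + ind S i j.+1 = 2 -> ~~ dd_v i j)].
Proof.
split=> [/and3P[cS /forallP S1 /forallP S2]|[cS Sh Sv]].
  split=> // i j i_n jn.
    have := S1 (vtx i.+1 j, vtx i.+1 j.+1); have := S2 (vtx i.+1 j, vtx i.+1 j.+1).
    rewrite side_count_h // => /implyP s2 /implyP s1; split=> E; [apply: s1|apply: s2]; exact/eqP.
  have := S1 (vtx i j.+1, vtx i.+1 j.+1); have := S2 (vtx i j.+1, vtx i.+1 j.+1).
  rewrite side_count_v // => /implyP s2 /implyP s1; split=> E; [apply: s1|apply: s2]; exact/eqP.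
have sideP s : 0 < side_count S s -> exists c, s \in sides c.
  by move/card_gt0P => [c]; rewrite inE => /andP[_]; exists c.
apply/and3P; split=> //; apply/forallP => s; apply/implyP => /eqP E.
  have [|c sc] := sideP s; first by rewrite E.
  move: E; apply: (@side_ind n (fun s => side_count S s = 1 -> double_directed G s.1 s.2)) sc => i j i_n jn.
    by rewrite side_count_h //; case: (Sh i j i_n jn).
  by rewrite side_count_v //; case: (Sv i j i_n jn).
have [|c sc] := sideP s; first by rewrite E.
move: E; apply: (@side_ind n (fun s => side_count S s = 2 -> ~~ double_directed G s.1 s.2)) sc => i j i_n jn.
  by rewrite side_count_h //; case: (Sh i j i_n jn).
by rewrite side_count_v //; case: (Sv i j i_n jn).
Qed.

(* Perturbations of corner sums along a face: constant across every segment
   whose orientation is the same at all vertices of the face. *)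
Record compatible d : Prop := Compatible {
  compat_outer : forall i j, ~~ inner n i j -> d i j = 0%R;
  compat_h : forall i j, i < n -> 0 < j < n -> ~~ dd_h i j -> d i.+1 j = d i j;
  compat_v : forall i j, 0 < i < n -> j < n -> ~~ dd_v i j -> d i j.+1 = d i j }.

(** Across a segment that is not doubled, the two values of the indicator cannot add up to 1; being
    0 or 1, they agree. *)
Lemma compat_ind S : doubly_directed_region G S ->
  compatible (fun i j => (ind S i j)%:R%R).
Proof.
case/regionP => _ Sh Sv; split=> i j.
- by move=> /ind_outer->.
- move=> i_n jn; have [+ _] := Sh i j i_n jn; move=> E /negP dd; congr (_%:R)%R.
  have := ind_le1 S i j; have := ind_le1 S i.+1 j.
  have: ind S i j + ind S i.+1 j <> 1 by move=> /E.
  lia.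
- move=> i_n jn; have [+ _] := Sv i j i_n jn; move=> E /negP dd; congr (_%:R)%R.
  have := ind_le1 S i j; have := ind_le1 S i j.+1.
  have: ind S i j + ind S i j.+1 <> 1 by move=> /E.
  lia.
Qed.

Definition cell_link : rel (cell n) := fun c c' =>
  [exists s : edge n, [&& s \in sides c, s \in sides c' & ~~ double_directed G s.1 s.2]].

(** These sets are the only candidates for regions; those linked to the outside fail. *)
Definition component c : {set cell n} := [set c' | connect cell_link c c']%SET.

Lemma cell_link_h c c' i j : i < n -> 0 < j < n -> ~~ dd_h i j ->
  at_pos c i j || at_pos c i.+1 j -> at_pos c' i j || at_pos c' i.+1 j ->
  cell_link c c'.
Proof.
move=> i_n jn dd cp cp'; apply/existsP; exists (vtx i.+1 j, vtx i.+1 j.+1).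
by rewrite !mem_sides_h // cp cp'.
Qed.

Lemma cell_link_v c c' i j : 0 < i < n -> j < n -> ~~ dd_v i j ->
  at_pos c i j || at_pos c i j.+1 -> at_pos c' i j || at_pos c' i j.+1 ->
  cell_link c c'.
Proof.
move=> i_n jn dd cp cp'; apply/existsP; exists (vtx i j.+1, vtx i.+1 j.+1).
by rewrite !mem_sides_v // cp cp'.
Qed.

Lemma compat_link d c c' : compatible d -> cell_link c c' ->
  d c.1.+1 c.2.+1 = d c'.1.+1 c'.2.+1.
Proof.
move=> [_ dh dv] /existsP[s /and3P[sc sc' dd]]; move: (sc) sc' dd.
apply: (@side_ind n (fun s => s \in sides c -> s \in sides c' ->
  ~~ double_directed G s.1 s.2 -> d c.1.+1 c.2.+1 = d c'.1.+1 c'.2.+1)) sc => i j i_n jn.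
  rewrite !mem_sides_h // => cp cp' dd; have E := dh i j i_n jn dd.
  by case/orP: cp => /andP[/eqP-> /eqP->]; case/orP: cp' => /andP[/eqP-> /eqP->].
rewrite !mem_sides_v // => cp cp' dd; have E := dv i j i_n jn dd.
by case/orP: cp => /andP[/eqP-> /eqP->]; case/orP: cp' => /andP[/eqP-> /eqP->].
Qed.

Lemma compat_connect d c c' : compatible d -> connect cell_link c c' ->
  d c.1.+1 c.2.+1 = d c'.1.+1 c'.2.+1.
Proof.
move=> dG /connectP[p]; elim: p c => [c _ -> //|c1 p IHp c /= /andP[l1 pp] E].
by rewrite (compat_link dG l1); apply: IHp.
Qed.

Lemma component_connected c : cell_connected (component c).
Proof.
set S := component c.
have cS : c \in S by rewrite inE.
have sub x p : x \in S -> path cell_link x p -> connect (cell_adj S) x (last x p).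
  elim: p x => [x _ _|y p IHp x xS /= /andP[xy pp]]; first exact: connect0.
  have yS : y \in S by move: xS; rewrite !inE => cx; apply: connect_trans cx (connect1 xy).
  apply: connect_trans (IHp y yS pp); apply: connect1.
  rewrite /cell_adj xS yS /=; case/existsP: xy => s /and3P[s1 s2 _].
  by apply/finset.set0Pn; exists s; rewrite inE s1.
have cC x : x \in S -> connect (cell_adj S) c x.
  by rewrite inE => /connectP[p pp ->]; exact: sub.
have symS : connect_sym (cell_adj S).
  by apply: sym_connect_sym => x y; rewrite /cell_adj andbCA finset.setIC.
apply/andP; split; first by apply/finset.set0Pn; exists c.
apply/'forall_implyP => x xS; apply/'forall_implyP => y yS.
by apply: connect_trans (cC y yS); rewrite symS cC.
Qed.

(** A region is closed under links because its indicator is compatible. Conversely, a side shared by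
    two distinct cells of the region has count 2, hence is not doubled, so adjacency inside the
    region is a link. In particular, distinct regions are disjoint. *)
Lemma region_component S c : doubly_directed_region G S -> c \in S ->
  S = component c.
Proof.
move=> Sreg cS; have [/andP[_ /'forall_implyP conS] Sh Sv] := (regionP S).1 Sreg.
have closed x y : x \in S -> cell_link x y -> y \in S.
  move=> xS /(compat_link (compat_ind Sreg)) /eqP.
  by rewrite !ind_cell xS eqr_nat; case: (y \in S).
have linkS x y : cell_adj S x y -> connect cell_link x y.
  case/and3P => xS yS /finset.set0Pn[s]; rewrite inE => /andP[sx sy].
  have [->|xy] := eqVneq x y; first exact: connect0.
  apply: connect1; apply/existsP; exists s; rewrite sx sy /=.
  have card2 : side_count S s = 2.
    apply/eqP; rewrite eqn_leq; apply/andP; split.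
      apply: (@side_ind n (fun s => side_count S s <= 2)) sx => i j i_n jn.
        by rewrite side_count_h // (leq_add (ind_le1 _ _ _) (ind_le1 _ _ _)).
      by rewrite side_count_v // (leq_add (ind_le1 _ _ _) (ind_le1 _ _ _)).
    have <- : #|[set x; y]%SET| = 2 by rewrite cards2 xy.
    by apply/subset_leq_card/fintype.subsetP => z; rewrite in_set2 => /orP[] /eqP ->; rewrite finset.in_set ?xS ?yS /=.
  by case/and3P: Sreg => _ _ /forallP/(_ s); rewrite card2.
apply/setP => x; rewrite inE; apply/idP/idP => [xS|].
  have /'forall_implyP/(_ x xS) := conS c cS.
  exact: (connect_sub (fun a b => linkS a b)).
case/connectP => p; elim: p c cS => [c cS _ -> //|y p IHp c cS /= /andP[cy pp] E].
exact: IHp (closed c y cS cy) pp E.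
Qed.

(** The property of [g(F)] that forbids a double directed segment with the same component on both
    sides. *)
Definition separated : Prop :=
  (forall i j, i < n -> 0 < j < n -> dd_h i j ->
     exists2 d, compatible d & d i.+1 j <> d i j) /\
  (forall i j, 0 < i < n -> j < n -> dd_v i j ->
     exists2 d, compatible d & d i j.+1 <> d i j).

(* Unless it is a region, a component reaches the outside. *)
Lemma compat_no_region d c : separated ->
  compatible d -> ~~ doubly_directed_region G (component c) ->
  d c.1.+1 c.2.+1 = 0%R.
Proof.
move=> [seph sepv] dG Sreg; set S := component c in Sreg.
apply/eqP; apply: contraNT Sreg => dc0; apply/regionP.
have compS x d' : compatible d' -> x \in S -> d' x.1.+1 x.2.+1 = d' c.1.+1 c.2.+1.
  by move=> dG'; rewrite inE => /(compat_connect dG').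
have posS i j d' : compatible d' -> ind S i j = 1 -> d' i j = d' c.1.+1 c.2.+1.
  move=> dG'; have [/inner_cell[x -> ->]|/ind_outer-> //] := boolP (inner n i j).
  by rewrite ind_cell; case: (boolP (x \in S)) => // xS _; exact: compS.
have closed x y : x \in S -> cell_link x y -> y \in S.
  by rewrite !inE => cx xy; apply: connect_trans cx (connect1 xy).
(* across an undoubled segment with exactly one side in the component, the
   other side can only be outside *)
have outer a b a' b' : ind S a b = 1 -> ind S a' b' = 0 ->
    (forall x y, at_pos x a b -> at_pos y a' b' -> cell_link x y) ->
    d a b = d a' b' -> False.
  move=> i1 i0 lnk; rewrite (posS _ _ d dG i1) => dE.
  have [out|inn] := boolP (inner n a' b').
    have [y ya yb] := inner_cell out.
    have [] : y \in S /\ y \notin S; last by move=> ->.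
    split; last by move: i0; rewrite ya yb ind_cell; case: (y \in S).
    have : inner n a b by apply/negPn/negP => /(ind_outer S); rewrite i1.
    case/inner_cell => x xa xb; apply: (closed x).
      by move: i1; rewrite xa xb ind_cell; case: (x \in S).
    by apply: lnk; rewrite ?xa ?xb ?ya ?yb at_posE.
  by move/eqP: dc0; apply; rewrite dE; case: dG => ->.
split; first exact: component_connected.
- move=> i j i_n jn; split=> [E|E].
    apply/negPn/negP => dd; have dE := compat_h dG i_n jn dd.
    have L x y : at_pos x i j || at_pos x i.+1 j -> at_pos y i j || at_pos y i.+1 j ->
      cell_link x y by exact: cell_link_h.
    have [[i1 i0]|[i1 i0]] : (ind S i j = 1 /\ ind S i.+1 j = 0) \/
      (ind S i.+1 j = 1 /\ ind S i j = 0) by lia.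
      by apply: (outer i j i.+1 j i1 i0) => // x y xp yp; apply: L; rewrite ?xp ?yp ?orbT.
    by apply: (outer i.+1 j i j i1 i0) => // x y xp yp; apply: L; rewrite ?xp ?yp ?orbT.
  (* Both sides of the segment lie in [S], where every compatible function is constant, so nothing
     can separate them. *)
  apply/negP => /(seph i j i_n jn)[d' dG']; apply.
  have := ind_le1 S i j; have := ind_le1 S i.+1 j => *.
  by rewrite (posS i j) ?(posS i.+1 j) //; lia.
- move=> i j i_n jn; split=> [E|E].
    apply/negPn/negP => dd; have dE := compat_v dG i_n jn dd.
    have L x y : at_pos x i j || at_pos x i j.+1 -> at_pos y i j || at_pos y i j.+1 ->
      cell_link x y by exact: cell_link_v.
    have [[i1 i0]|[i1 i0]] : (ind S i j = 1 /\ ind S i j.+1 = 0) \/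
      (ind S i j.+1 = 1 /\ ind S i j = 0) by lia.
      by apply: (outer i j i j.+1 i1 i0) => // x y xp yp; apply: L; rewrite ?xp ?yp ?orbT.
    by apply: (outer i j.+1 i j i1 i0) => // x y xp yp; apply: L; rewrite ?xp ?yp ?orbT.
  apply/negP => /(sepv i j i_n jn)[d' dG']; apply.
  have := ind_le1 S i j; have := ind_le1 S i j.+1 => *.
  by rewrite (posS i j) ?(posS i j.+1) //; lia.
Qed.

(** On a region the choice of the cell is immaterial, since a compatible [d] is constant there. The
    value 0 is returned only for the empty set. *)
Definition value_on d S : R :=
  if [pick c in S] is Some c then d c.1.+1 c.2.+1 else 0%R.

Lemma value_onE d S c : compatible d -> doubly_directed_region G S -> c \in S ->
  value_on d S = d c.1.+1 c.2.+1.
Proof.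
move=> dG Sreg cS; rewrite /value_on; case: pickP => [c' c'S|/(_ c)]; last by rewrite cS.
apply: compat_connect dG _; move: cS; rewrite (region_component Sreg c'S) inE.
by [].
Qed.

(** A cell whose component is a region lies in no other region, so a single term survives. Any other
    cell lies in no region, and [d] vanishes on it. Hence the indicators of regions span the
    compatible functions. *)
Lemma compat_decomp d i j : separated -> compatible d ->
  d i j = (\sum_(S | doubly_directed_region G S) value_on d S * (ind S i j)%:R)%R.
Proof.
move=> sepG dG.
have [/inner_cell[c -> ->]|out] := boolP (inner n i j); last first.
  by rewrite big1 ?(compat_outer dG) // => S _; rewrite ind_outer // mulr0.
have [creg|creg] := boolP (doubly_directed_region G (component c)); last first.
  rewrite (compat_no_region sepG dG creg) big1 // => S Sreg.
  rewrite ind_cell; have [cS|_] := boolP (c \in S); last by rewrite mulr0.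
  by move: creg; rewrite -(region_component Sreg cS) Sreg.
have cc : c \in component c by rewrite inE.
rewrite (bigD1 (component c)) //= ind_cell cc mulr1 (value_onE dG creg cc).
rewrite big1 ?addr0 // => S /andP[Sreg Sc]; rewrite ind_cell.
have [cS|_] := boolP (c \in S); last by rewrite mulr0.
by move: Sc; rewrite -(region_component Sreg cS) eqxx.
Qed.

End Regions.

(** * Circulations and cycles *)

Section Circulations.
Variables (R : realType).
Local Open Scope ring_scope.

(* Following a positive edge at each vertex eventually closes a cycle, which has
   length at least 3 by antisymmetry. *)
Lemma circulation_cycle (T : finType) (f : T -> T -> R) :
  (forall v w, f v w = - f w v) -> (forall v, \sum_w f v w = 0) ->
  (exists v w, f v w != 0) ->
  exists c, (2 < size c)%N /\ ucycle (fun v w => 0 < f v w) c.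
Proof.
move=> fN f0 [v0 [w0 fv0]].
pose succ v := odflt v [pick w | 0 < f v w].
pose live v := [exists w, 0 < f v w].
have live_succ v : live v -> 0 < f v (succ v).
  by rewrite /succ => /existsP[w fw]; case: pickP => //= /(_ w); rewrite fw.
have succ_live v : live v -> live (succ v).
  move=> /live_succ fv; apply: contraT; rewrite /live negb_exists => /forallP nw.
  (* If no value out of [succ v] were positive, the negative value back to [v] would make the total
     negative. *)
  have : \sum_w f (succ v) w < 0.
    rewrite (bigD1 v) //= -[ltRHS]addr0 ltr_leD //; first by rewrite fN oppr_lt0.
    by apply: sumr_le0 => w _; rewrite leNgt nw.
  by rewrite f0 ltxx.
have [x xl] : exists x, live x.
  case: (ltgtP (f v0 w0) 0) fv0 => // fv _; [exists w0|exists v0]; apply/existsP.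
    by exists v0; rewrite fN oppr_gt0.
  by exists w0.
have iter_live y k : live y -> live (iter k succ y).
  by move=> yl; elim: k => //= k; exact: succ_live.
have [k kT ek] : exists2 k, (k < #|T|)%N & iter #|T| succ x = iter k succ x.
  have : looping succ x #|T|.
    rewrite -[looping _ _ _]negbK -looping_uniq; apply/negP => /card_uniqP E.
    by have := max_card (mem (traject succ x #|T|.+1)); rewrite E size_traject ltnn.
  by move/trajectP => [k kT E]; exists k.
pose y := iter k succ x; have yl : live y by exact: iter_live.
have exq : exists q, iter q.+1 succ y == y.
  exists (#|T| - k).-1; rewrite prednK ?subn_gt0 // /y -iterD subnK ?(ltnW kT) //.
  by rewrite ek.
(* The least period of [y] is taken, so that the closed orbit has no repetition. *)
case: (ex_minnP exq) => q /eqP yq qmin.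
exists (traject succ y q.+1); split.
  rewrite size_traject; case: q yq qmin => [|[|//]] /= yq _.
    have := live_succ y yl; rewrite yq => fy.
    by have := fN y y; lra.
  have := live_succ y yl; have := live_succ _ (succ_live y yl); rewrite yq.
  by rewrite fN oppr_gt0 => f1 /(lt_trans f1); rewrite ltxx.
apply/andP; split.
  have pth z m : live z -> path (fun v w => 0 < f v w) z (traject succ (succ z) m).
    by elim: m z => //= m IHm z zl; rewrite live_succ // IHm // succ_live.
  have -> : cycle (fun v w => 0 < f v w) (traject succ y q.+1) =
    path (fun v w => 0 < f v w) y (rcons (traject succ (succ y) q) y) by [].
  have -> : rcons (traject succ (succ y) q) y = traject succ (succ y) q.+1.
    by rewrite trajectSr -iterSr yq.
  exact: pth.
rewrite looping_uniq; apply/negP => /trajectP[l lq E].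
have := qmin l; rewrite iterS -E -iterS yq eqxx => /(_ isT); lia.
Qed.

(** The alternative [x = 0] serves the vertices that have no neighbour in the direction selected by
    [P]. *)
Lemma sum_pred1 (T : finType) (P : pred T) (x : R) :
  x = 0 \/ (exists w0, forall w, P w = (w == w0)) ->
  \sum_w (P w)%:R * x = x.
Proof.
case=> [->|[w0 Pw]]; first by rewrite big1 // => w _; rewrite mulr0.
rewrite (bigD1 w0) //= Pw eqxx mul1r big1 ?addr0 // => w ww.
by rewrite Pw (negbTE ww) mul0r.
Qed.

End Circulations.

Section Flow.
Variables (R : realType) (n : nat).
Local Open Scope ring_scope.
Local Notation vtx := (vtx n).
Implicit Types (d : nat -> nat -> R) (v w : vertex n).

Lemma leftwardE v w : leftward (v, w) = rightward (w, v).
Proof. by rewrite /leftward /rightward /= eq_sym. Qed.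

Lemma upwardE v w : upward (v, w) = downward (w, v).
Proof. by rewrite /upward /downward /= eq_sym. Qed.

(* The circulation whose value on a directed edge is the jump of [d] from the
   cell on its left to the cell on its right. *)
Definition flow_r d v w : R := (rightward (v, w))%:R * (d v.1 v.2 - d v.1.-1 v.2).
Definition flow_l d v w : R :=
  (leftward (v, w))%:R * (d v.1.-1 v.2.-1 - d v.1 v.2.-1).
Definition flow_d d v w : R := (downward (v, w))%:R * (d v.1 v.2.-1 - d v.1 v.2).
Definition flow_u d v w : R :=
  (upward (v, w))%:R * (d v.1.-1 v.2 - d v.1.-1 v.2.-1).

Definition flow d v w : R :=
  flow_r d v w + flow_l d v w + flow_d d v w + flow_u d v w.

Lemma flow_rl d v w : flow_r d v w = - flow_l d w v.
Proof.
rewrite /flow_r /flow_l leftwardE.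
have [/andP[/eqP /= -> /eqP ->]|_] := boolP (rightward (v, w)); rewrite /=; ring.
Qed.

Lemma flow_du d v w : flow_d d v w = - flow_u d w v.
Proof.
rewrite /flow_d /flow_u upwardE.
have [/andP[/eqP /= -> /eqP ->]|_] := boolP (downward (v, w)); rewrite /=; ring.
Qed.

Lemma flowN d v w : flow d v w = - flow d w v.
Proof.
rewrite /flow (flow_rl d v w) (flow_du d v w) (flow_rl d w v) (flow_du d w v); ring.
Qed.

Lemma flow_lin a b d d' v w :
  flow (fun i j => a * d i j + b * d' i j) v w = a * flow d v w + b * flow d' v w.
Proof. rewrite /flow /flow_r /flow_l /flow_d /flow_u; ring. Qed.

(** The four jumps telescope around the four positions that meet at [v]. Where a neighbour is
    missing, both positions are outer and the jump is 0. *)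
Lemma flow_sum d v : (forall i j, ~~ inner n i j -> d i j = 0) ->
  \sum_w flow d v w = 0.
Proof.
move=> d0; have v1 := ltn_ord v.1; have v2 := ltn_ord v.2.
rewrite /flow !big_split /= !sum_pred1; first by ring.
- have [v0|v0] := posnP v.1; first by left; rewrite v0 /= !d0 ?subrr // /inner; lia.
  right; exists (vtx v.1.-1 v.2) => w.
  rewrite -(vtx_val w) -{1}(vtx_val v) upward_vtx ?eq_vtx; have := ltn_ord w.1; have := ltn_ord w.2; lia.
- have [v0|v0] : v.1 = n.+1 :> nat \/ (v.1 < n.+1)%N by lia.
    by left; rewrite v0 /= !d0 ?subrr // /inner; lia.
  right; exists (vtx v.1.+1 v.2) => w.
  rewrite -(vtx_val w) -{1}(vtx_val v) downward_vtx ?eq_vtx; have := ltn_ord w.1; have := ltn_ord w.2; lia.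
- have [v0|v0] := posnP v.2; first by left; rewrite v0 /= !d0 ?subrr // /inner; lia.
  right; exists (vtx v.1 v.2.-1) => w.
  rewrite -(vtx_val w) -{1}(vtx_val v) leftward_vtx ?eq_vtx; have := ltn_ord w.1; have := ltn_ord w.2; lia.
- have [v0|v0] : v.2 = n.+1 :> nat \/ (v.2 < n.+1)%N by lia.
    by left; rewrite v0 /= !d0 ?subrr // /inner; lia.
  right; exists (vtx v.1 v.2.+1) => w.
  rewrite -(vtx_val w) -{1}(vtx_val v) rightward_vtx ?eq_vtx; have := ltn_ord w.1; have := ltn_ord w.2; lia.
Qed.

Lemma flow_right d i j : (i <= n)%N -> (j <= n)%N ->
  flow d (vtx i.+1 j) (vtx i.+1 j.+1) = d i.+1 j - d i j.
Proof.
move=> i_n jn; rewrite /flow /flow_r /flow_l /flow_d /flow_u !dir_vtx; try lia.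
rewrite !eqxx !eqn_SF /= !inordK //; try lia.
rewrite /=; ring.
Qed.

Lemma flow_eq0 d : (forall i j, ~~ inner n i j -> d i j = 0) ->
  (forall v w, flow d v w = 0) -> forall i j, d i j = 0.
Proof.
move=> d0 f0 i j; have [/andP[/andP[_ i_n] /andP[_ jn]]|/d0 //] := boolP (inner n i j).
elim: i i_n => [|i IHi] i_n; first by rewrite d0 // /inner; lia.
have := f0 (vtx i.+1 j) (vtx i.+1 j.+1); rewrite flow_right; try lia.
by rewrite IHi ?(ltnW i_n) // subr0.
Qed.

Variable G : grid n.

Lemma double_directedC v w : double_directed G v w = double_directed G w v.
Proof. by rewrite /double_directed andbC. Qed.

Lemma flow_r_dd d v w : compatible G d -> flow_r d v w != 0 -> double_directed G v w.
Proof.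
move=> [d0 dh _]; rewrite /flow_r; have [/andP[/eqP /= w1 /eqP /= w2]|_] := boolP (rightward (v, w)); last by rewrite mul0r eqxx.
rewrite mul1r subr_eq0 => dv.
have [v1 v2] : (0 < v.1 <= n)%N /\ (0 < v.2 < n)%N.
  have : inner n v.1 v.2 || inner n v.1.-1 v.2.
    by apply: contraNT dv; rewrite negb_or => /andP[/d0-> /d0->].
  have : nat_of_ord v.1 != 0%N by apply: contraNneq dv => ->.
  by rewrite /inner; lia.
rewrite -(vtx_val v) -(vtx_val w) w1 w2.
apply: contraNT dv => ndd; apply/eqP.
have := dh v.1.-1 v.2; rewrite /dd_h prednK; last by lia.
by apply=> //; lia.
Qed.

Lemma flow_d_dd d v w : compatible G d -> flow_d d v w != 0 -> double_directed G v w.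
Proof.
move=> [d0 _ dv]; rewrite /flow_d; have [/andP[/eqP /= w1 /eqP /= w2]|_] := boolP (downward (v, w)); last by rewrite mul0r eqxx.
rewrite mul1r subr_eq0 => dvv.
have [v1 v2] : (0 < v.1 < n)%N /\ (0 < v.2 <= n)%N.
  have : inner n v.1 v.2 || inner n v.1 v.2.-1.
    by apply: contraNT dvv; rewrite negb_or => /andP[/d0-> /d0->].
  have : nat_of_ord v.2 != 0%N by apply: contraNneq dvv => ->.
  by rewrite /inner; lia.
rewrite -(vtx_val v) -(vtx_val w) w1 w2.
apply: contraNT dvv => ndd; apply/eqP.
have := dv v.1 v.2.-1; rewrite /dd_v prednK; last by lia.
by move=> -> //; lia.
Qed.

Lemma flow_dd d v w : compatible G d -> flow d v w != 0 -> double_directed G v w.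
Proof.
move=> dG; apply: contraNT => ndd; rewrite /flow.
have E (x : R) : (x != 0 -> double_directed G v w) -> x = 0.
  by move=> H; apply/eqP/negPn/negP => /H; apply/negP.
have r0 : flow_r d v w = 0 by apply: E; exact: flow_r_dd.
have d0 : flow_d d v w = 0 by apply: E; exact: flow_d_dd.
have l0 : flow_l d v w = 0.
  apply: E; rewrite -[flow_l d v w]opprK -(flow_rl d w v) oppr_eq0 double_directedC.
  exact: flow_r_dd.
have u0 : flow_u d v w = 0.
  apply: E; rewrite -[flow_u d v w]opprK -(flow_du d w v) oppr_eq0 double_directedC.
  exact: flow_d_dd.
by rewrite r0 d0 l0 u0 !addr0.
Qed.

(** The flow of [d] is nonzero because [d] can be recovered from it, and it lives on double directed
    edges because [d] jumps nowhere else. The nonvanishing on the cycle is kept, to compare the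
    cycle with a given one. *)
Lemma compat_cycle d : compatible G d -> (exists i j, d i j != 0) ->
  exists c, [/\ (2 < size c)%N, ucycle (double_directed G) c
    & forall v w, (v, w) \in cycle_edges c -> flow d v w != 0].
Proof.
move=> dG [i [j dij]].
have [|c [c2 /andP[cyc uc]]] := circulation_cycle (flowN d) (fun v => flow_sum v (compat_outer dG)).
  have [//|nf] := pselect (exists v w, flow d v w != 0).
  case/eqP: dij; apply: (flow_eq0 (compat_outer dG)) => v w.
  by apply/eqP/negPn/negP => f0; apply: nf; exists v, w.
exists c; split=> //.
  apply/andP; split=> //; apply: sub_cycle cyc => v w fvw.
  by apply: (flow_dd dG); rewrite gt_eqF.
move=> v w; rewrite inE /= => /orP[/andP[vc /eqP->]|/andP[wc /eqP->]].
  by rewrite gt_eqF // (next_cycle cyc vc).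
by rewrite flowN oppr_eq0 gt_eqF // (next_cycle cyc wc).
Qed.

Hypothesis GC : G \subset complete_flow_grid n.

Lemma dd_complete v w : double_directed G v w -> (v, w) \in complete_flow_grid n.
Proof. by case/andP => /(fintype.subsetP GC). Qed.

Lemma dd_internal v w : double_directed G v w -> internal v.
Proof. by move/dd_complete; rewrite inE => /andP[]. Qed.

Section Potential.
Variable f : vertex n -> vertex n -> R.
Hypotheses (fN : forall v w, f v w = - f w v) (f_sum : forall v, \sum_w f v w = 0)
  (f_dd : forall v w, f v w != 0 -> double_directed G v w).

Let f_out1 v w : ~~ internal v -> f v w = 0.
Proof. by move=> nv; apply/eqP; apply: contraNT nv => /f_dd/dd_internal. Qed.

Let f_out2 v w : ~~ internal w -> f v w = 0.
Proof. by move=> nw; rewrite fN f_out1 ?oppr0. Qed.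

Lemma ninternal1 i j : ~~ (0 < i <= n)%N -> ~~ internal (vtx i j).
Proof.
move=> i_n; rewrite /internal /= negb_and; apply/orP; left.
by rewrite /inord /insubd; case: insubP => /= [u _ ->|] //; lia.
Qed.

Lemma ninternal2 i j : ~~ (0 < j <= n)%N -> ~~ internal (vtx i j).
Proof.
move=> i_n; rewrite /internal /= negb_and; apply/orP; right.
by rewrite /inord /insubd; case: insubP => /= [u _ ->|] //; lia.
Qed.

(** Integration of [f] down a column, starting from 0 above the grid. Conservation at the vertices
    makes the result independent of the path, so this inverts [flow]. *)
Definition potential i j : R := \sum_(k < i) f (vtx k.+1 j) (vtx k.+1 j.+1).

Let potS i j : potential i.+1 j = potential i j + f (vtx i.+1 j) (vtx i.+1 j.+1).
Proof. by rewrite /potential big_ord_recr. Qed.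

Let pot0 j : potential 0 j = 0.
Proof. by rewrite /potential big_ord0. Qed.

Let pot_out i j : ~~ (0 < j < n)%N -> potential i j = 0.
Proof.
move=> jn; rewrite /potential big1 // => k _.
have [j0|j0] := posnP j; first by apply/f_out1/ninternal2; rewrite j0.
by apply/f_out2/ninternal2; lia.
Qed.

Let f_cons i j : (i < n)%N -> (j < n)%N ->
  f (vtx i.+1 j.+1) (vtx i.+1 j.+2) + f (vtx i.+1 j.+1) (vtx i.+1 j) +
  f (vtx i.+1 j.+1) (vtx i.+2 j.+1) + f (vtx i.+1 j.+1) (vtx i j.+1) = 0.
Proof.
move=> i_n jn; pose s := [:: vtx i.+1 j.+2; vtx i.+1 j; vtx i.+2 j.+1; vtx i j.+1].
have [i0 i1 j0 j1] : [/\ i <= n.+1, i.+1 <= n.+1, j <= n.+1 & j.+1 <= n.+1]%N by split; lia.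
have us : uniq s by rewrite /= !inE !eq_vtx // ?eqSS ?eqn_SF ?eqxx.
rewrite -[RHS](f_sum (vtx i.+1 j.+1)) [RHS](bigID (mem s)) /= [X in _ = _ + X]big1 ?addr0.
  by rewrite -(big_uniq _ us) /= !big_cons big_nil addr0 !addrA.
move=> w ws; apply/eqP; apply: contraNT ws => /f_dd/dd_complete.
have w1 := ltn_ord w.1; have w2 := ltn_ord w.2.
rewrite -(vtx_val w) mem_complete // => /andP[_] E; rewrite !inE !eq_vtx //; lia.
Qed.

Let pot_v i j : (i <= n)%N -> (j < n)%N ->
  potential i j - potential i j.+1 = f (vtx i j.+1) (vtx i.+1 j.+1).
Proof.
elim: i => [|i IHi] i_n jn.
  by rewrite !pot0 subrr f_out1 // ninternal1.
rewrite !potS; have := f_cons i_n jn; have := IHi (ltnW i_n) jn.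
rewrite [f _ (vtx i.+1 j)]fN [f _ (vtx i j.+1)]fN; lra.
Qed.

(** The vertical segments below row [n] end in boundary vertices and carry no flow, so the potential
    is constant along its row [n], starting from 0. *)
Let pot_n j : potential n j = 0.
Proof.
elim: j => [|j IHj]; first exact: pot_out.
have [jn|jn] := ltnP j n; last by apply: pot_out; lia.
have := pot_v (leqnn n) jn; rewrite IHj f_out2; first by lra.
by apply: ninternal1; lia.
Qed.

Let pot_big i j : (n <= i)%N -> potential i j = 0.
Proof.
elim: i => [|i IHi]; first by rewrite pot0.
rewrite leq_eqVlt => /orP[/eqP <-|ni]; first exact: pot_n.
by rewrite potS IHi // f_out1 ?addr0 // ninternal1; lia.
Qed.

Lemma potential_compat : compatible G potential.
Proof.
split=> i j.
- rewrite negb_and => /orP[io|]; last exact: pot_out.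
  by have [->|i0] := posnP i; [exact: pot0|apply: pot_big; lia].
- move=> i_n jn ndd; rewrite potS; have [->|/f_dd] := eqVneq (f (vtx i.+1 j) (vtx i.+1 j.+1)) 0; first by rewrite addr0.
  by move/negP: ndd.
- move=> i_n jn ndd; have := pot_v (ltnW (proj2 (andP i_n))) jn.
  have [->|/f_dd] := eqVneq (f (vtx i j.+1) (vtx i.+1 j.+1)) 0; first by lra.
  by move/negP: ndd.
Qed.

Lemma flow_potential v w : flow potential v w = f v w.
Proof.
have R_ a b : rightward (a, b) -> f a b = potential a.1 a.2 - potential a.1.-1 a.2.
  move=> /andP[/eqP /= b1 /eqP /= b2]; rewrite -(vtx_val a) -(vtx_val b) b1 b2 /= !inord_val.
  case: (nat_of_ord a.1) => [|i]; last by rewrite potS addrAC subrr add0r.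
  by rewrite subrr f_out1 // ninternal1.
have D_ a b : downward (a, b) -> f a b = potential a.1 a.2.-1 - potential a.1 a.2.
  move=> /andP[/eqP /= b1 /eqP /= b2]; rewrite -(vtx_val a) -(vtx_val b) b1 b2 /= !inord_val.
  have := ltn_ord a.2; have := ltn_ord b.1; rewrite b2.
  case: (nat_of_ord a.2) => [|j] ha hj /=; first by rewrite subrr f_out1 // ninternal2.
  have [jn|jn] := ltnP j n; first by rewrite pot_v //; lia.
  by rewrite !pot_out ?subrr ?f_out1 // ?ninternal2 //; lia.
have excl : (rightward (v, w) + leftward (v, w) + downward (v, w) + upward (v, w) <= 1)%N.
  rewrite /rightward /leftward /downward /upward /= -!val_eqE /=; lia.
have fl : flow_l potential v w = - flow_r potential w v by rewrite flow_rl opprK.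
have fu : flow_u potential v w = - flow_d potential w v by rewrite flow_du opprK.
rewrite /flow fl fu /flow_r /flow_d -(leftwardE v w) -(upwardE v w).
have [r|r] := boolP (rightward (v, w)).
  rewrite (_ : leftward _ = false) 1?(_ : downward _ = false) 1?(_ : upward _ = false); try lia.
  by rewrite R_ //=; ring.
have [l|l] := boolP (leftward (v, w)).
  rewrite (_ : downward _ = false) 1?(_ : upward _ = false); try lia.
  by rewrite fN R_ -?leftwardE //=; ring.
have [dd|dd] := boolP (downward (v, w)).
  rewrite (_ : upward _ = false); try lia.
  by rewrite D_ //=; ring.
have [u|u] := boolP (upward (v, w)).
  by rewrite fN D_ -?upwardE //=; ring.
have -> : f v w = 0; last by rewrite /=; ring.
apply/eqP/negPn/negP => /f_dd/dd_complete; rewrite inE /horizontal /vertical.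
by rewrite (negbTE r) (negbTE l) (negbTE dd) (negbTE u) andbF.
Qed.

End Potential.

Section CycleFlow.
Variable c : seq (vertex n).
Hypotheses (c2 : (2 < size c)%N) (cG : ucycle (double_directed G) c).

Definition cycle_flow v w : R :=
  ((v \in c) && (w == next c v))%:R - ((w \in c) && (v == next c w))%:R.

(** Here the length of at least 3 matters: on a cycle of length 2 the two terms of [cycle_flow]
    would cancel. *)
Lemma next_next v : v \in c -> next c (next c v) != v.
Proof.
case/andP: cG => _ uc /rot_to[k s E].
rewrite -!(next_rot k uc); move: c2 uc; rewrite -(size_rot k) -(rot_uniq k) E.
case: s {E} => [|a [|b s]] //= _ /andP[]; rewrite !inE !negb_or => /and3P[va vb _] _.
by rewrite !eqxx [a == v]eq_sym (negbTE va) eq_sym.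
Qed.

Lemma cycle_flow_edges v w : ((v, w) \in cycle_edges c) = (cycle_flow v w != 0).
Proof.
rewrite inE /cycle_flow /=.
have [/andP[vc /eqP ->]|_] := boolP ((v \in c) && _).
  by rewrite [v == _]eq_sym (negbTE (next_next vc)) andbF subr0 oner_eq0.
case: (_ && _); last by rewrite subrr eqxx.
by rewrite sub0r oppr_eq0 oner_eq0.
Qed.

Lemma cycle_flowN v w : cycle_flow v w = - cycle_flow w v.
Proof. by rewrite /cycle_flow opprB. Qed.

Lemma cycle_flow_sum v : \sum_w cycle_flow v w = 0.
Proof.
case/andP: cG => _ uc; rewrite sumrB.
have [vc|vc] := boolP (v \in c); last first.
  rewrite !big1 ?subrr // => w _; have [wc|//] := boolP (w \in c).
  by have [vw|//] := eqVneq v (next c w); rewrite vw mem_next wc in vc.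
rewrite (bigD1 (next c v)) //= eqxx big1 => [|w /negbTE-> //].
rewrite (bigD1 (prev c v)) //= mem_prev vc next_prev // eqxx big1 ?addr0 ?subrr //.
move=> w wv; have [wc /=|//] := boolP (w \in c).
by have [E|//] := eqVneq v (next c w); case/eqP: wv; rewrite E prev_next.
Qed.

Lemma cycle_flow_dd v w : cycle_flow v w != 0 -> double_directed G v w.
Proof.
case/andP: cG => cyc _; rewrite -cycle_flow_edges inE /=.
move=> /orP[]/andP[vc /eqP->]; first exact: next_cycle cyc vc.
by rewrite double_directedC; exact: next_cycle cyc vc.
Qed.

Lemma cycle_compat : exists2 d, compatible G d & flow d =2 cycle_flow.
Proof.
exists (potential cycle_flow).
  exact: (potential_compat cycle_flowN cycle_flow_sum cycle_flow_dd).
move=> v w; exact: (flow_potential cycle_flowN cycle_flow_sum cycle_flow_dd).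
Qed.

End CycleFlow.

End Flow.

(** * Rounding sums of alternating sign matrices that cover a grid *)

Section Covered.
Variables (R : realType) (n : nat) (G : grid n).
Local Notation vtx := (vtx n).
Implicit Types h : nat -> nat -> nat.

(** Heights are unconstrained beyond [n], while a compatible function must vanish at every outer
    position; hence the cut-off. Within the range it changes nothing, because the boundary values
    are fixed. *)
Definition height_diff h h' i j : R :=
  if inner n i j then ((h i j)%:R - (h' i j)%:R)%R else 0%R.

Lemma height_diffE h h' i j : height n 1 h -> height n 1 h' ->
  i <= n -> j <= n -> height_diff h h' i j = ((h i j)%:R - (h' i j)%:R)%R.
Proof.
move=> [h1 h2 h3 h4 _ _] [h1' h2' h3' h4' _ _] i_n jn; rewrite /height_diff.
case: ifPn => //; rewrite /inner => out.
have [->|i0] := posnP i; first by rewrite h1 h1' subrr.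
have [->|j0] := posnP j; first by rewrite h2 h2' subrr.
have [->|in'] := eqVneq i n; first by rewrite h3 // h3' // subrr.
have -> : j = n by lia.
by rewrite h4 // h4' // subrr.
Qed.

(** Both heights orient each segment inside [G]. If only one orientation is available there, their
    differences across the segment coincide. *)
Lemma compat_height_diff h h' : height n 1 h -> height n 1 h' ->
  grid_of_height n h \subset G -> grid_of_height n h' \subset G ->
  compatible G (height_diff h h').
Proof.
move=> hh hh' /fintype.subsetP hG /fintype.subsetP hG'; split=> i j.
- by rewrite /height_diff => /negbTE->.
- move=> i_n jn; have jn' : j <= n by lia.
  rewrite !height_diffE ?(ltnW i_n) // /dd_h /double_directed => ndd.
  have := hG (vtx i.+1 j, vtx i.+1 j.+1); have := hG' (vtx i.+1 j, vtx i.+1 j.+1).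
  have := hG (vtx i.+1 j.+1, vtx i.+1 j); have := hG' (vtx i.+1 j.+1, vtx i.+1 j).
  rewrite !mem_grid // => g1 g2 g3 g4.
  have := height_down hh i_n jn'; have := height_down hh' i_n jn' => s s'.
  have E : h i.+1 j + h' i j = h i j + h' i.+1 j.
    by move: ndd; do 2 case: (_ \in G) in g1 g2 g3 g4 *; lia.
  have : ((h i.+1 j)%:R + (h' i j)%:R = (h i j)%:R + (h' i.+1 j)%:R :> R)%R.
    by rewrite -!natrD E.
  by move=> {}E; apply/eqP; rewrite subr_eq addrAC -E addrK.
- move=> i_n jn; have i_n' : i <= n by lia.
  rewrite !height_diffE ?(ltnW jn) // /dd_v /double_directed => ndd.
  have := hG (vtx i j.+1, vtx i.+1 j.+1); have := hG' (vtx i j.+1, vtx i.+1 j.+1).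
  have := hG (vtx i.+1 j.+1, vtx i j.+1); have := hG' (vtx i.+1 j.+1, vtx i j.+1).
  rewrite !mem_grid // => g1 g2 g3 g4.
  have := height_right hh i_n' jn; have := height_right hh' i_n' jn => s s'.
  have E : h i j.+1 + h' i j = h i j + h' i j.+1.
    by move: ndd; do 2 case: (_ \in G) in g1 g2 g3 g4 *; lia.
  have : ((h i j.+1)%:R + (h' i j)%:R = (h i j)%:R + (h' i j.+1)%:R :> R)%R.
    by rewrite -!natrD E.
  by move=> {}E; apply/eqP; rewrite subr_eq addrAC -E addrK.
Qed.

Section SumSteps.
Variables (m : nat) (a b : 'I_m -> nat).
Hypothesis ab : forall k, a k <= b k <= a k + 1.

Lemma sum_lt_exists : \sum_k a k < \sum_k b k -> exists k, a k < b k.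
Proof.
move=> lt; have [k kP|no] := pickP (fun k => a k < b k); first by exists k.
by move: lt; rewrite ltnNge leq_sum // => k _; rewrite leqNgt no.
Qed.

Lemma exists_sum_lt k : a k < b k -> \sum_k a k < \sum_k b k.
Proof.
move=> kP; rewrite (bigD1 k) //= [X in _ < X](bigD1 k) //= -addSn leq_add //.
by apply: leq_sum => l _; case/andP: (ab l).
Qed.

Lemma sum_addm : \sum_k a k + m = \sum_k (a k).+1.
Proof.
under [RHS]eq_bigr do rewrite -addn1.
by rewrite big_split /= sum_nat_const card_ord muln1.
Qed.

End SumSteps.

Lemma sum_eq_exists m (a b : 'I_m -> nat) : (forall k, a k <= b k <= a k + 1) ->
  \sum_k b k < \sum_k a k + m -> exists k, a k = b k.
Proof.
move=> ab; rewrite sum_addm => /sum_lt_exists[k kP]; exists k.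
by have := ab k; lia.
Qed.

Lemma exists_sum_eq m (a b : 'I_m -> nat) k : (forall k, a k <= b k <= a k + 1) ->
  a k = b k -> \sum_k b k < \sum_k a k + m.
Proof.
move=> ab kP; rewrite sum_addm; apply: (@exists_sum_lt _ _ _ _ k); last by rewrite kP.
by move=> l; have := ab l; lia.
Qed.

Variables (m : nat) (h : 'I_m -> nat -> nat -> nat).
Hypotheses (hh : forall k, height n 1 (h k))
  (hG : forall k, grid_of_height n (h k) \subset G)
  (cov : forall e, e \in G -> exists k, e \in grid_of_height n (h k)).

Let H0 i j := \sum_k h k i j.

Lemma mem_cov e k : e \in grid_of_height n (h k) -> e \in G.
Proof. exact: (fintype.subsetP (hG k)). Qed.

Lemma cov_right i j : i < n -> j <= n ->
  ((vtx i.+1 j, vtx i.+1 j.+1) \in G) = (H0 i j < H0 i.+1 j).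
Proof.
move=> i_n jn; have st k := height_down (hh k) i_n jn.
apply/idP/idP => [/cov[k]|/sum_lt_exists[k kP]].
  by rewrite mem_grid //; exact: exists_sum_lt.
by apply: (@mem_cov _ k); rewrite mem_grid.
Qed.

Lemma cov_left i j : i < n -> j <= n ->
  ((vtx i.+1 j.+1, vtx i.+1 j) \in G) = (H0 i.+1 j < H0 i j + m).
Proof.
move=> i_n jn; have st k := height_down (hh k) i_n jn.
apply/idP/idP => [/cov[k]|/(sum_eq_exists st)[k kP]].
  by rewrite mem_grid // => /eqP; exact: exists_sum_eq.
by apply: (@mem_cov _ k); rewrite mem_grid // kP.
Qed.

Lemma cov_down i j : i <= n -> j < n ->
  ((vtx i j.+1, vtx i.+1 j.+1) \in G) = (H0 i j < H0 i j.+1).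
Proof.
move=> i_n jn; have st k := height_right (hh k) i_n jn.
apply/idP/idP => [/cov[k]|/sum_lt_exists[k kP]].
  by rewrite mem_grid //; exact: exists_sum_lt.
by apply: (@mem_cov _ k); rewrite mem_grid.
Qed.

Lemma cov_up i j : i <= n -> j < n ->
  ((vtx i.+1 j.+1, vtx i j.+1) \in G) = (H0 i j.+1 < H0 i j + m).
Proof.
move=> i_n jn; have st k := height_right (hh k) i_n jn.
apply/idP/idP => [/cov[k]|/(sum_eq_exists st)[k kP]].
  by rewrite mem_grid // => /eqP; exact: exists_sum_eq.
by apply: (@mem_cov _ k); rewrite mem_grid // kP.
Qed.

Lemma covered_complete : G \subset complete_flow_grid n.
Proof.
apply/fintype.subsetP => e /cov[k].
exact: (fintype.subsetP (grid_of_height_complete n (h k))).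
Qed.

(** Two members of the family that orient the segment oppositely differ by a compatible function
    that jumps across it. *)
Lemma covered_separated : separated R G.
Proof.
have neq (a b c d : nat) : a < b -> c = d ->
    (b%:R - d%:R <> a%:R - c%:R :> R)%R.
  by move=> ab -> /eqP; rewrite (inj_eq (addIr _)) eqr_nat; lia.
split=> i j i_n jn /andP[/cov[k +] /cov[l +]].
  have jn' : j <= n by lia.
  rewrite !mem_grid // => kP /eqP lP; exists (height_diff (h k) (h l)).
    exact: compat_height_diff.
  by rewrite !height_diffE ?(ltnW i_n) //; exact: neq.
have i_n' : i <= n by lia.
rewrite !mem_grid // => kP /eqP lP; exists (height_diff (h k) (h l)).
  exact: compat_height_diff.
by rewrite !height_diffE ?(ltnW jn) //; exact: neq.
Qed.

(** Where [h'] steps by 1, [H0] has a positive step, and where [h'] is constant, [H0] steps by less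
    than [m]. So [H0 - h'] has steps between 0 and [m.-1] and can be rounded; [1 < m] keeps the
    divisor positive. *)
Lemma round_complement h' : 1 < m -> height n 1 h' ->
  grid_of_height n h' \subset G ->
  exists2 B : 'I_m.-1 -> nat -> nat -> nat, (forall k, height n 1 (B k)) &
    forall i j, i <= n -> j <= n -> \sum_k B k i j + h' i j = H0 i j.
Proof.
move=> m1 hh' /fintype.subsetP hG'.
have [s1 s2 s3 s4 s5 s6] := height_sum hh; rewrite -/H0 in s1 s2 s3 s4 s5 s6.
have [t1 t2 t3 t4 t5 t6] := hh'.
have down i j : i < n -> j <= n ->
    H0 i j + h' i.+1 j <= H0 i.+1 j + h' i j < H0 i j + h' i.+1 j + m.
  move=> i_n jn; have := t5 i j i_n jn; have := s5 i j i_n jn; rewrite -/(H0 _ _) -/(H0 _ _).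
  have := hG' (vtx i.+1 j, vtx i.+1 j.+1); have := hG' (vtx i.+1 j.+1, vtx i.+1 j).
  rewrite cov_right // cov_left // !mem_grid //; lia.
have right i j : i <= n -> j < n ->
    H0 i j + h' i j.+1 <= H0 i j.+1 + h' i j < H0 i j + h' i j.+1 + m.
  move=> i_n jn; have := t6 i j i_n jn; have := s6 i j i_n jn; rewrite -/(H0 _ _) -/(H0 _ _).
  have := hG' (vtx i j.+1, vtx i.+1 j.+1); have := hG' (vtx i.+1 j.+1, vtx i j.+1).
  rewrite cov_down // cov_up // !mem_grid //; lia.
have le i j : i <= n -> j <= n -> h' i j <= H0 i j.
  elim: i => [|i IHi] i_n jn; first by rewrite t1.
  (* With this bound, the truncated subtraction in [H] is exact. *)
  by have := down i j i_n jn; have := IHi (ltnW i_n) jn; lia.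
pose H i j := H0 i j - h' i j.
have m0 : 0 < m.-1 by lia.
have hH : height n m.-1 H.
  split=> [j|i|j jn|i i_n|i j i_n jn|i j i_n jn]; rewrite /H.
  - by rewrite /H0 s1.
  - by rewrite /H0 s2.
  - by rewrite /H0 s3 // t3 //; nia.
  - by rewrite /H0 s4 // t4 //; nia.
  - have := down i j i_n jn; have := le i j (ltnW i_n) jn; have := le i.+1 j i_n jn; lia.
  - have := right i j i_n jn; have := le i j i_n (ltnW jn); have := le i j.+1 i_n jn; lia.
exists (fun (k : 'I_m.-1) i j => (H i j + k) %/ m.-1) => [k|i j i_n jn].
  exact: height_round hH.
by rewrite sum_divn_shift // /H subnK // le.
Qed.

(** The indicator changes a difference only across a double directed segment, where that of [H0] is
    strictly between 0 and [m]. An extremal difference stays as it is and is rounded to the same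
    orientation in every summand, so no summand leaves [G]. *)
Lemma round_region S : 0 < m -> doubly_directed_region G S ->
  exists2 B : 'I_m -> nat -> nat -> nat,
    (forall k, height n 1 (B k) /\ grid_of_height n (B k) \subset G) &
    forall i j, \sum_k B k i j = H0 i j + ind S i j.
Proof.
move=> m0 Sreg.
have [s1 s2 s3 s4 s5 s6] := height_sum hh; rewrite -/H0 in s1 s2 s3 s4 s5 s6.
have out i j : ~~ inner n i j -> ind S i j = 0 by exact: ind_outer.
have down i j : i < n -> j <= n -> ~~ dd_h G i j -> ind S i.+1 j = ind S i j.
  move=> i_n jn ndd; have [jn'|jn'] := boolP (0 < j < n); last by rewrite !out // /inner; lia.
  by have /eqP := compat_h (compat_ind R Sreg) i_n jn' ndd; rewrite eqr_nat => /eqP.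
have right i j : i <= n -> j < n -> ~~ dd_v G i j -> ind S i j.+1 = ind S i j.
  move=> i_n jn ndd; have [jn'|jn'] := boolP (0 < i < n); last by rewrite !out // /inner; lia.
  by have /eqP := compat_v (compat_ind R Sreg) jn' jn ndd; rewrite eqr_nat => /eqP.
have le1 := ind_le1 S.
pose H i j := H0 i j + ind S i j.
have hH : height n m H.
  split=> [j|i|j jn|i i_n|i j i_n jn|i j i_n jn]; rewrite /H.
  - by rewrite /H0 s1 out // /inner; lia.
  - by rewrite /H0 s2 out // /inner; lia.
  - by rewrite /H0 s3 // out ?addn0 // /inner; lia.
  - by rewrite /H0 s4 // out ?addn0 // /inner; lia.
  - have := s5 i j i_n jn; rewrite -/(H0 _ _) -/(H0 _ _).
    have := le1 i j; have := le1 i.+1 j; have := down i j i_n jn.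
    rewrite /dd_h /double_directed cov_right // cov_left //; lia.
  - have := s6 i j i_n jn; rewrite -/(H0 _ _) -/(H0 _ _).
    have := le1 i j; have := le1 i j.+1; have := right i j i_n jn.
    rewrite /dd_v /double_directed cov_down // cov_up //; lia.
exists (fun (k : 'I_m) i j => (H i j + k) %/ m) => [k|i j]; last first.
  by rewrite sum_divn_shift.
have hB : height n 1 (fun i j => (H i j + k) %/ m) by exact: height_round hH.
(* An orientation seen after rounding, 1 here and 0 in [diveq], needs a difference of [H] that is
   positive, respectively below [m]. *)
have divlt a b : (a + k) %/ m < (b + k) %/ m -> a < b.
  by apply: contraTT; rewrite -!leqNgt => ba; apply: leq_div2r; lia.
have diveq a b : (a + k) %/ m = (b + k) %/ m -> b < a + m.
  move=> E; rewrite ltnNge; apply/negP => ba.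
  have : (a + k + m) %/ m <= (b + k) %/ m by apply: leq_div2r; lia.
  by rewrite (divnDr _ (dvdnn m)) divnn m0 E; lia.
split=> //; apply/fintype.subsetP => e eB.
have eC := fintype.subsetP (grid_of_height_complete _ _) e eB.
move: eB; apply: (@complete_edge_ind n (fun e => e \in grid_of_height n _ -> e \in G)) eC => i j.
- move=> i_n /andP[j0 jn]; rewrite mem_grid // cov_right // => /divlt; rewrite /H.
  have := down i j i_n jn; rewrite /dd_h /double_directed cov_right // cov_left //; lia.
- move=> i_n jn; rewrite mem_grid ?(ltnW jn) // cov_left ?(ltnW jn) // => /eqP/diveq; rewrite /H.
  have := down i j i_n (ltnW jn); rewrite /dd_h /double_directed cov_right ?(ltnW jn) // cov_left ?(ltnW jn) //; lia.
- move=> /andP[j0 i_n] jn; rewrite mem_grid // cov_down // => /divlt; rewrite /H.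
  have := right i j i_n jn; rewrite /dd_v /double_directed cov_down // cov_up //; lia.
- move=> i_n jn; rewrite mem_grid ?(ltnW i_n) // cov_up ?(ltnW i_n) // => /eqP/diveq; rewrite /H.
  have := right i j (ltnW i_n) jn; rewrite /dd_v /double_directed cov_down ?(ltnW i_n) // cov_up ?(ltnW i_n) //; lia.
Qed.

End Covered.

(** * One region versus one cycle *)

Section RegionsAndCycles.
Variables (R : realType) (n : nat) (G : grid n).
Hypotheses (GC : G \subset complete_flow_grid n) (sepG : separated R G).
Local Open Scope ring_scope.

Lemma region_cell S : doubly_directed_region G S -> exists c, c \in S.
Proof. by case/regionP => /andP[/finset.set0Pn]. Qed.

Lemma cycle_edges_next (c : seq (vertex n)) : (2 < size c)%N ->
  exists v, (v, next c v) \in cycle_edges c.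
Proof.
by case: c => // v c _; exists v; rewrite inE /= inE !eqxx.
Qed.

(** With a single region, every compatible function is a multiple of its indicator. All cycle flows
    are then nonzero multiples of one flow and share its support, which is the edge set of each
    cycle. *)
Lemma one_region_one_cycle : num_regions G = 1%N ->
  exists! E : {set edge n}, double_directed_cycle G E.
Proof.
move=> /eqP/cards1P[S regS].
have SE S' : doubly_directed_region G S' = (S' == S).
  by have /setP/(_ S') := regS; rewrite !inE.
have Sreg : doubly_directed_region G S by rewrite SE.
pose d0 i j : R := (ind S i j)%:R.
have dec d i j : compatible G d -> d i j = value_on d S * d0 i j.
  by move=> dG; rewrite (compat_decomp i j sepG dG) (eq_bigl _ _ SE) big_pred1_eq.
have edgesE c : (2 < size c)%N -> ucycle (double_directed G) c ->
    forall v w, ((v, w) \in cycle_edges c) = (flow d0 v w != 0).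
  move=> c2 cG; have [d dG df] := cycle_compat R GC c2 cG.
  have E v w : cycle_flow R c v w = value_on d S * flow d0 v w.
    rewrite -df -[RHS]addr0 -[X in _ = _ + X](mul0r (flow d0 v w)) -flow_lin.
    by congr (flow _ v w); apply/funext => i; apply/funext => j; rewrite mul0r addr0 dec.
  move=> v w; rewrite (cycle_flow_edges R c2 cG) E mulf_eq0.
  have [v0] := cycle_edges_next c2; rewrite (cycle_flow_edges R c2 cG) E.
  by have [->|//] := eqVneq (value_on d S) 0; rewrite mul0r eqxx.
have [x xS] := region_cell Sreg.
have [|c [c2 cG _]] := compat_cycle (compat_ind R Sreg).
  by exists x.1.+1, x.2.+1; rewrite ind_cell xS oner_eq0.
exists (cycle_edges c); split; first by exists c.
move=> _ [c' [c2' cG' ->]]; apply/setP => -[v w].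
by rewrite !edgesE.
Qed.

Lemma one_cycle_one_region :
  (exists! E : {set edge n}, double_directed_cycle G E) -> num_regions G = 1%N.
Proof.
move=> [E [[c [c2 cG EE]] uniqE]].
have [d dG df] := cycle_compat R GC c2 cG.
have [v ve] := cycle_edges_next c2.
have fv : flow d v (next c v) != 0 by rewrite df -(cycle_flow_edges R c2 cG).
have [S Sreg] : exists S, doubly_directed_region G S.
  have [S //|no] := pickP (fun S => doubly_directed_region G S); first by exists S.
  case/eqP: fv; have -> : d = fun _ _ => 0; last by rewrite /flow /flow_r /flow_l /flow_d /flow_u; ring.
  apply/funext => i; apply/funext => j; rewrite (compat_decomp i j sepG dG) big1 // => S.
  by rewrite no.
(* two regions would give a nonzero circulation avoiding an edge of the unique
   cycle, and its support contains another cycle *)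
have nocirc d' : compatible G d' -> (exists i j, d' i j != 0) -> flow d' v (next c v) != 0.
  move=> dG' /(compat_cycle dG')[c' [c2' cG' fc']]; apply: fc'.
  have <- : E = cycle_edges c' by apply: uniqE; exists c'.
  by rewrite EE.
have nz T : doubly_directed_region G T -> exists i j, (ind T i j)%:R != 0 :> R.
  by move=> /region_cell[x xT]; exists x.1.+1, x.2.+1; rewrite ind_cell xT oner_eq0.
apply/eqP/cards1P; exists S; apply/setP => S'; rewrite !inE.
apply/idP/eqP => [Sreg'|->//]; apply/eqP/negPn/negP => SS'.
pose dS i j : R := (ind S i j)%:R; pose dS' i j : R := (ind S' i j)%:R.
have cS := compat_ind R Sreg; have cS' := compat_ind R Sreg'.
pose a := flow dS v (next c v); pose b := flow dS' v (next c v).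
have a0 : a != 0 by apply: nocirc (nz S Sreg).
(* The coefficients are chosen so that the flow cancels on the distinguished edge. The combination
   is still nonzero, because the regions are disjoint and [a] is nonzero. *)
suff /nocirc : compatible G (fun i j => b * dS i j + (- a) * dS' i j).
  rewrite flow_lin -/a -/b mulrC mulNr subrr eqxx => H; apply: notF; apply: H.
  have [x xS'] := region_cell Sreg'; exists x.1.+1, x.2.+1.
  have xS : x \notin S.
    apply: contra SS' => xS; rewrite (region_component R Sreg xS).
    by rewrite -(region_component R Sreg' xS').
  by rewrite /dS /dS' !ind_cell xS' (negbTE xS) mulr0 add0r mulr1 oppr_eq0.
split=> i j.
- by move=> ij; rewrite /dS /dS' !ind_outer // !mulr0 addr0.
- by move=> i_n jn ndd; rewrite /dS /dS' (compat_h cS i_n jn ndd) (compat_h cS' i_n jn ndd).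
- by move=> i_n jn ndd; rewrite /dS /dS' (compat_v cS i_n jn ndd) (compat_v cS' i_n jn ndd).
Qed.

End RegionsAndCycles.

(** * Faces of the polytope *)

Section LinearFunctionals.
Variables (R : realType) (n : nat).
Local Open Scope ring_scope.
Local Notation dotmx := Defs.dotmx.
Implicit Types (C A X : 'M[R]_n).

Lemma dotmx_sum C (I : Type) (r : seq I) (Q : pred I) (p : I -> 'M[R]_n) :
  dotmx C (\sum_(i <- r | Q i) p i) = \sum_(i <- r | Q i) dotmx C (p i).
Proof.
rewrite /dotmx [RHS]exchange_big; apply: eq_bigr => i _ /=.
rewrite [RHS]exchange_big; apply: eq_bigr => j _ /=.
by rewrite summxE mulr_sumr.
Qed.

Lemma dotmxZ C a X : dotmx C (a *: X) = a * dotmx C X.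
Proof.
rewrite /dotmx mulr_sumr; apply: eq_bigr => i _.
by rewrite mulr_sumr; apply: eq_bigr => j _; rewrite mxE mulrCA.
Qed.

Lemma dotmxD C X Y : dotmx C (X + Y) = dotmx C X + dotmx C Y.
Proof.
rewrite /dotmx -big_split; apply: eq_bigr => i _ /=.
by rewrite -big_split; apply: eq_bigr => j _ /=; rewrite mxE mulrDr.
Qed.

Lemma dotmx_comb C k (p : 'I_k -> 'M[R]_n) (a : 'I_k -> R) :
  dotmx C (\sum_i a i *: p i) = \sum_i a i * dotmx C (p i).
Proof. by rewrite dotmx_sum; under eq_bigr do rewrite dotmxZ. Qed.

Definition functional (phi : 'M[R]_n -> R) := exists C, forall X, dotmx C X = phi X.

Lemma functional_entry i j : functional (fun X => X i j).
Proof.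
exists (delta_mx i j) => X; rewrite /dotmx (bigD1 i) //= (bigD1 j) //=.
rewrite mxE !eqxx mul1r [X in _ + X + _]big1 ?addr0 => [|l /negbTE lj].
  rewrite big1 ?addr0 // => k /negbTE ki.
  by rewrite big1 // => l _; rewrite mxE ki mul0r.
by rewrite mxE lj andbF mul0r.
Qed.

Lemma functional_sum (I : finType) (Q : pred I) (phi : I -> 'M[R]_n -> R) :
  (forall i, functional (phi i)) -> functional (fun X => \sum_(i | Q i) phi i X).
Proof.
move=> /choice[C CE]; exists (\sum_(i | Q i) C i) => X.
transitivity (\sum_(i | Q i) dotmx (C i) X); last by apply: eq_bigr.
rewrite /dotmx [RHS]exchange_big; apply: eq_bigr => i _ /=.
rewrite [RHS]exchange_big; apply: eq_bigr => j _ /=.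
by rewrite summxE mulr_suml.
Qed.

Lemma functional_scale a phi : functional phi -> functional (fun X => a * phi X).
Proof.
case=> C CE; exists (a *: C) => X; rewrite -CE -dotmxZ /dotmx.
by apply: eq_bigr => i _; apply: eq_bigr => j _; rewrite !mxE -mulrA mulrCA.
Qed.

Lemma functional_partial_sum i j (e : edge n) :
  functional (fun X => partial_sum X i j e).
Proof.
rewrite /partial_sum.
by case: (rightward e); last case: (leftward e); last case: (downward e);
  apply: functional_sum => k; exact: functional_entry.
Qed.

Lemma partial_sum01 A i j (e : edge n) : is_ASM A ->
  partial_sum A i j e = 0 \/ partial_sum A i j e = 1.
Proof.
move=> aA; have [_ row1 col1 _ _] := aA; have [h hh AE] := ASM_height aA.
have or1 (x : R) : x = 0 \/ x = 1 -> 1 - x = 0 \/ 1 - x = 1.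
  by case=> ->; [right; rewrite subr0|left; rewrite subrr].
have ri := ltn_ord i; have rj := ltn_ord j.
have rowE m : (m <= n)%N -> \sum_(k < n | (k < m)%N) A i k = 0 \/ \sum_(k < n | (k < m)%N) A i k = 1.
  by move=> mn; rewrite AE asm_of_rowsum //; exact/height1_diff/(height_down hh).
have colE m : (m <= n)%N -> \sum_(k < n | (k < m)%N) A k j = 0 \/ \sum_(k < n | (k < m)%N) A k j = 1.
  by move=> mn; rewrite AE asm_of_colsum //; exact/height1_diff/(height_right hh).
rewrite /partial_sum; case: ifP => _; last case: ifP => _; last case: ifP => _.
- exact: (rowE j.+1).
- by rewrite big_ge row1; apply/or1/rowE/ltnW.
- exact: (colE i.+1).
- by rewrite (big_ge (fun k => A k j)) col1; apply/or1/colE/ltnW.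
Qed.

(** On an alternating sign matrix, [phi] counts the edges of its flow grid outside [G], since each
    partial sum is 0 or 1. Its negative is therefore maximal, with value 0, exactly on the matrices
    whose grid stays in [G]. *)
Lemma grid_functional (G : grid n) : exists C,
  forall A, is_ASM A -> dotmx C A <= 0 /\ (dotmx C A = 0 <-> flow_grid_of A \subset G).
Proof.
pose phi X := \sum_(e in complete_flow_grid n :\: G) \sum_(i < n) \sum_(j < n)
  (e.1 == vtx n i.+1 j.+1)%:R * partial_sum X i j e.
have [C CE] : functional phi.
  apply: functional_sum => e; apply: functional_sum => i; apply: functional_sum => j.
  exact/functional_scale/functional_partial_sum.
exists (- C) => A aA.
have -> : dotmx (- C) A = - phi A.
  by rewrite -CE -scaleN1r -[RHS]mulN1r -dotmxZ /dotmx; apply: eq_bigr => i _;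
    apply: eq_bigr => j _; rewrite !mxE mulrCA mulrA.
have ge0 (e : edge n) (i j : 'I_n) : 0 <= (e.1 == vtx n i.+1 j.+1)%:R * partial_sum A i j e.
  by rewrite mulr_ge0 ?ler0n //; case: (partial_sum01 i j e aA) => ->.
have ge0j (e : edge n) (i : 'I_n) : 0 <= \sum_(j < n) (e.1 == vtx n i.+1 j.+1)%:R * partial_sum A i j e.
  exact: sumr_ge0.
have ge0i (e : edge n) : 0 <= \sum_(i < n) \sum_(j < n) (e.1 == vtx n i.+1 j.+1)%:R * partial_sum A i j e.
  exact: sumr_ge0.
split; first by rewrite oppr_le0 sumr_ge0.
split=> [/eqP|AG].
  rewrite oppr_eq0 => /eqP; rewrite /phi => /psumr_eq0P E.
  apply/fintype.subsetP => e; rewrite inE => /andP[eC /existsP[i /existsP[j /andP[ev /eqP ps]]]].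
  apply/negPn/negP => eG; have := E (fun e _ => ge0i e) e.
  rewrite inE eG eC => /(_ isT)/psumr_eq0P E1; have := E1 (fun i _ => ge0j e i) i isT.
  move=> /psumr_eq0P E2; have /eqP := E2 (fun j _ => ge0 e i j) j isT.
  by rewrite ev ps mulr1 oner_eq0.
apply/eqP; rewrite oppr_eq0 /phi big1 // => e; rewrite inE => /andP[eG eC].
rewrite big1 // => i _; rewrite big1 // => j _.
have [ev|_] := eqVneq; last by rewrite mul0r.
have [->|ps] := partial_sum01 i j e aA; first by rewrite mulr0.
case/negP: eG; apply: (fintype.subsetP AG); rewrite inE eC /=.
by apply/existsP; exists i; apply/existsP; exists j; rewrite ev ps !eqxx.
Qed.

End LinearFunctionals.

Section Faces.
Variables (R : realType) (n : nat).
Local Open Scope ring_scope.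
Local Notation dotmx := Defs.dotmx.
Implicit Types (C A X : 'M[R]_n) (F : set 'M[R]_n).

Lemma conv_max k (a f : 'I_k -> R) b : (forall i, 0 <= a i) -> \sum_i a i = 1 ->
  (forall i, f i <= b) -> \sum_i a i * f i = b -> forall i, a i != 0 -> f i = b.
Proof.
move=> a0 a1 fb fE i ai.
have E : \sum_i a i * (b - f i) = 0.
  under eq_bigr do rewrite mulrBr.
  by rewrite sumrB -mulr_suml a1 mul1r fE subrr.
have/psumr_eq0P H := E.
have /eqP := H (fun i _ => mulr_ge0 (a0 i) (etrans (subr_ge0 _ _) (fb i))) i isT.
by rewrite mulf_eq0 (negbTE ai) subr_eq0 => /eqP.
Qed.

Lemma sum1_neq0 k (a : 'I_k -> R) : \sum_i a i = 1 -> exists i, a i != 0.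
Proof.
move=> a1; have [i ai|no] := pickP (fun i => a i != 0); first by exists i.
by move: a1; rewrite big1 => [/esym/eqP|i _]; rewrite ?oner_eq0 //; apply/eqP/negbFE/no.
Qed.

Lemma ASM_in_polytope A : is_ASM A -> ASM_polytope A.
Proof.
move=> aA; exists 1%N, (fun=> A), (fun=> 1); by split=> //; rewrite big_ord1 ?scale1r.
Qed.

Lemma polytope_le C b X : (forall A, is_ASM A -> dotmx C A <= b) ->
  ASM_polytope X -> dotmx C X <= b.
Proof.
move=> Cb [k [p [a [pA a0 a1 ->]]]]; rewrite dotmx_comb.
rewrite -[leRHS]mul1r -a1 mulr_suml; apply: ler_sum => i _.
by rewrite ler_wpM2l // Cb.
Qed.

Lemma face_conv C b X : (forall A, is_ASM A -> dotmx C A <= b) ->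
  ASM_polytope X -> dotmx C X = b ->
  exists (k : nat) (p : 'I_k -> 'M[R]_n) (a : 'I_k -> R),
    [/\ forall i, is_ASM (p i) /\ dotmx C (p i) = b, forall i, 0 <= a i,
        \sum_i a i = 1 & X = \sum_i a i *: p i].
Proof.
move=> Cb [k [p [a [pA a0 a1 XE]]]] CX.
have [i0 ai0] := sum1_neq0 a1.
have fE i : a i != 0 -> dotmx C (p i) = b.
  apply: (@conv_max k a (fun i => dotmx C (p i))) => // [l|]; first exact: Cb.
  by rewrite -dotmx_comb -XE.
(* Points of weight 0 may lie outside the face; they are replaced by one of nonzero weight. *)
exists k, (fun i => if a i == 0 then p i0 else p i), a; split=> // [i|].
  by case: ifPn => [_|/fE]; split=> //; exact: fE.
by rewrite XE; apply: eq_bigr => i _; case: eqP => // ->; rewrite !scale0r.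
Qed.

Lemma flow_grid_inj A B : is_ASM A -> is_ASM B ->
  flow_grid_of A \subset flow_grid_of B -> A = B.
Proof.
move=> /ASM_height[h hh ->] /ASM_height[h' hh' ->].
rewrite !flow_grid_of_asm // => sub.
have E := grid_of_height_inj hh hh' sub.
by apply/matrixP => i j; rewrite !mxE !E // ltnW.
Qed.

(** A vertex is a convex combination of alternating sign matrices of [F], and its exposing
    functional makes one of them equal to it. Conversely, [A] is exposed by the functional that
    penalises the edges outside its own grid, because no other alternating sign matrix has its grid
    inside that of [A]. *)
Lemma face_vertex F A : is_face (@ASM_polytope R n) F ->
  is_vertex F A <-> is_ASM A /\ F A.
Proof.
move=> [C [b [Cb FE]]].
have CbA B : is_ASM B -> dotmx C B <= b by move/ASM_in_polytope/Cb.
split=> [[C' [b' [Cb' AE]]]|[aA FA]].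
  have [FA C'A] : F A /\ dotmx C' A = b'.
    by have : [set A]%classic A by []; rewrite AE.
  split=> //; move: (FA); rewrite FE => -[PA CA].
  have [k [p [a [pA a0 a1 XE]]]] := face_conv CbA PA CA.
  have Fp i : F (p i) by rewrite FE; case: (pA i) => /ASM_in_polytope.
  have [i ai] := sum1_neq0 a1.
  have C'p : dotmx C' (p i) = b'.
    apply: (@conv_max k a (fun i => dotmx C' (p i))) ai => // [l|]; first exact: Cb'.
    by rewrite -dotmx_comb -XE.
  have : [set A]%classic (p i) by rewrite AE.
  by move=> <-; case: (pA i).
have [C' C'P] := grid_functional R (flow_grid_of A).
have C'0 B : is_ASM B -> dotmx C' B <= 0 by case/C'P.
exists C', 0; split=> [X|].
  by rewrite FE => -[PX _]; exact: polytope_le PX.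
apply/seteqP; split=> [_ -> |X [FX C'X]] /=.
  by split=> //; apply/(C'P A aA).2.
move: FX; rewrite FE => -[PX _].
have [k [p [a [pA a0 a1 ->]]]] := face_conv C'0 PX C'X.
rewrite (eq_bigr (fun i => a i *: A)) => [|i _]; first by rewrite -scaler_suml a1 scale1r.
by congr (_ *: _); case: (pA i) => pi /(C'P _ pi).2; exact: flow_grid_inj.
Qed.

Lemma mem_flow_grid_of_face F e : is_face (@ASM_polytope R n) F ->
  e \in flow_grid_of_face F <->
  exists A, [/\ is_ASM A, F A & e \in flow_grid_of A].
Proof.
move=> Ff; rewrite inE; split.
  by move=> /asboolP[A /(face_vertex A Ff)[aA FA] eA]; exists A.
by move=> [A [aA FA eA]]; apply/asboolP; exists A => //; apply/face_vertex.
Qed.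

Lemma face_ASM F : is_face (@ASM_polytope R n) F -> (F !=set0)%classic ->
  exists A, is_ASM A /\ F A.
Proof.
move=> [C [b [Cb FE]]] [X]; rewrite FE => -[PX CX].
have [|k [p [a [pA _ /sum1_neq0[i _] _]]]] := face_conv _ PX CX.
  by move=> A /ASM_in_polytope/Cb.
exists (p i); case: (pA i) => aA CA; split=> //; split=> //.
exact: ASM_in_polytope.
Qed.

Lemma cover_family (V : (nat -> nat -> nat) -> Prop) (G : grid n) :
  (exists h, V h) ->
  (forall e, e \in G -> exists h, V h /\ e \in grid_of_height n h) ->
  exists (m : nat) (h : 'I_m -> nat -> nat -> nat),
    [/\ (1 < m)%N, forall k, V (h k) &
        forall e, e \in G -> exists k, e \in grid_of_height n (h k)].
Proof.
move=> [h0 Vh0] cov.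
have /choice[f fP] : forall e : edge n, exists h, V h /\ (e \in G -> e \in grid_of_height n h).
  move=> e; have [/cov[h [Vh eh]]|eG] := boolP (e \in G); first by exists h.
  by exists h0.
(* One member is taken for each pair of vertices, with [h0] as filler outside [G]. There are
   [(n + 2) ^ 4] pairs, which gives [1 < m] even for [n = 0]. *)
exists #|edge n|, (fun k => f (enum_val k)); split=> [|k|e eG].
- by rewrite !card_prod !card_ord; nia.
- by case: (fP (enum_val k)).
- by exists (enum_rank e); rewrite enum_rankK; case: (fP e) => _; apply.
Qed.

Lemma asm_of_sum m (h : 'I_m -> nat -> nat -> nat) :
  asm_of R n (fun i j => \sum_k h k i j)%N = \sum_k asm_of R n (h k).
Proof.
apply/matrixP => i j; rewrite mxE summxE !natr_sum -!sumrB -big_split /=.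
by apply: eq_bigr => k _; rewrite mxE.
Qed.

Lemma asm_ofD (h h' : nat -> nat -> nat) :
  asm_of R n (fun i j => h i j + h' i j)%N = asm_of R n h + asm_of R n h'.
Proof. by apply/matrixP => i j; rewrite !mxE !natrD; ring. Qed.

Lemma eq_asm_of (h h' : nat -> nat -> nat) :
  (forall i j, (i <= n)%N -> (j <= n)%N -> h i j = h' i j) ->
  asm_of R n h = asm_of R n h'.
Proof. by move=> E; apply/matrixP => i j; rewrite !mxE !E // ltnW. Qed.

Lemma face_family F : is_face (@ASM_polytope R n) F -> (F !=set0)%classic ->
  exists (m : nat) (h : 'I_m -> nat -> nat -> nat),
    [/\ (1 < m)%N, forall k, height n 1 (h k) /\ F (asm_of R n (h k)),
        forall k, grid_of_height n (h k) \subset flow_grid_of_face F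
      & forall e, e \in flow_grid_of_face F ->
          exists k, e \in grid_of_height n (h k)].
Proof.
move=> Ff Fn.
have [||m [h [m1 Vh cov]]] := @cover_family
  (fun h => height n 1 h /\ F (asm_of R n h)) (flow_grid_of_face F).
- have [A [/ASM_height[h hh AE] FA]] := face_ASM Ff Fn.
  by exists h; rewrite -AE.
- move=> e /(mem_flow_grid_of_face e Ff)[A [/ASM_height[h hh AE] FA eA]].
  by exists h; rewrite -AE -(flow_grid_of_asm R hh) -AE.
exists m, h; split=> // k; apply/fintype.subsetP => e ek.
have [hh Fh] := Vh k; apply/(mem_flow_grid_of_face e Ff).
by exists (asm_of R n (h k)); split=> //; [exact: asm_of_ASM|rewrite flow_grid_of_asm].
Qed.

(* The sum of the family minus [B] is again a sum of alternating sign matrices,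
   so [B] attains the maximum of the functional defining [F]. *)
Lemma face_grid_closed F B : is_face (@ASM_polytope R n) F -> (F !=set0)%classic ->
  is_ASM B -> flow_grid_of B \subset flow_grid_of_face F -> F B.
Proof.
move=> Ff Fn aB sub; have [m [h [m1 hF hG cov]]] := face_family Ff Fn.
have hh k := (hF k).1.
have [h' hh' BE] := ASM_height aB; rewrite BE flow_grid_of_asm // in sub.
have [D hD DE] := round_complement hh hG cov m1 hh' sub.
have [C [b [Cb FE]]] := Ff; rewrite FE; split; first exact: ASM_in_polytope.
have E : \sum_k asm_of R n (D k) + B = \sum_k asm_of R n (h k).
  by rewrite BE -!asm_of_sum -asm_ofD; apply: eq_asm_of.
have CE : \sum_k dotmx C (asm_of R n (D k)) + dotmx C B = m%:R * b.
  rewrite -dotmx_sum -dotmxD E dotmx_sum (eq_bigr (fun=> b)) ?sumr_const ?card_ord ?mulr_natl //.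
  by move=> k _; have [_] := hF k; rewrite FE => -[].
have le1 : \sum_k dotmx C (asm_of R n (D k)) <= m.-1%:R * b.
  rewrite mulr_natl -[X in b *+ X]card_ord -sumr_const; apply: ler_sum => k _.
  exact/Cb/ASM_in_polytope/asm_of_ASM.
have le2 : dotmx C B <= b by exact/Cb/ASM_in_polytope.
have mE : m%:R * b = m.-1%:R * b + b.
  by rewrite -{1}(prednK (ltnW m1)) -natr1 mulrDl mul1r.
by apply/le_anti; rewrite le2 /=; lra.
Qed.

Lemma face_eq F F' : is_face (@ASM_polytope R n) F -> is_face (@ASM_polytope R n) F' ->
  (forall A, is_ASM A -> F A <-> F' A) -> F = F'.
Proof.
have sub E E' : is_face (@ASM_polytope R n) E -> is_face (@ASM_polytope R n) E' ->
    (forall A, is_ASM A -> E A -> E' A) -> (E `<=` E')%classic.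
  move=> [C [b [Cb EE]]] [C' [b' [Cb' EE']]] EE1 X; rewrite {1}EE => -[PX CX].
  have [|k [p [a [pA a0 a1 XE]]]] := face_conv _ PX CX.
    by move=> A /ASM_in_polytope/Cb.
  rewrite EE'; split=> //; rewrite XE dotmx_comb (eq_bigr (fun i => a i * b')).
    by rewrite -mulr_suml a1 mul1r.
  move=> i _; have [aA CA] := pA i; congr (_ * _).
  have : E' (p i) by apply: EE1 => //; rewrite EE; split=> //; exact: ASM_in_polytope.
  by rewrite EE' => -[].
move=> Ff Ff' FF; apply/seteqP; split; apply: sub => // A aA; by apply FF.
Qed.

End Faces.

(** * Dimension of a face *)

Section Dimension.
Variables (R : realType) (n : nat).
Local Open Scope ring_scope.
Implicit Types (A X : 'M[R]_n) (F : set 'M[R]_n).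

(** Appending [A] and [B] with weights [- t] and [t] keeps the total weight 1. *)
Lemma aff_hull_move F Y A B t : aff_hull F Y -> F A -> F B ->
  aff_hull F (Y + t *: (B - A)).
Proof.
move=> [k [p [a [Fp a1 ->]]]] FA FB.
exists (k + 2)%N,
  (fun i => match fintype.split i with inl x => p x
            | inr y => if y == ord0 then A else B end),
  (fun i => match fintype.split i with inl x => a x
            | inr y => if y == ord0 then - t else t end).
have sl (x : 'I_k) : fintype.split (lshift 2 x) = inl x := unsplitK (inl x).
have sr (x : 'I_2) : fintype.split (rshift k x) = inr x := unsplitK (inr x).
split=> [i||].
- by case: (fintype.split i) => // y; case: ifP.
- rewrite big_split_ord /=; under eq_bigr do rewrite sl.
  under [X in _ + X]eq_bigr do rewrite sr.
  by rewrite a1 big_ord_recl big_ord1 /= addNr addr0.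
- rewrite [RHS]big_split_ord /=; under [X in _ = X + _]eq_bigr do rewrite sl.
  under [X in _ = _ + X]eq_bigr do rewrite sr.
  by rewrite big_ord_recl big_ord1 /= scaleNr scalerBr [t *: B - _]addrC.
Qed.

Lemma aff_hull_moves F (I : finType) Y (A B : I -> 'M[R]_n) t : aff_hull F Y ->
  (forall i, F (A i)) -> (forall i, F (B i)) ->
  aff_hull F (Y + t *: \sum_i (B i - A i)).
Proof.
move=> FY FA FB; rewrite scaler_sumr; elim/big_rec: _ => [|i x _ Fx]; first by rewrite addr0.
by rewrite addrA addrAC; exact: aff_hull_move.
Qed.

Lemma has_dim_uniq F d d' : has_dim F d -> has_dim F d' -> d = d'.
Proof.
have sub (X0 X1 : 'M[R]_n) (U U' : {vspace 'M[R]_n}) :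
    ([set X | X - X0 \in U] `<=` [set X | X - X1 \in U'])%classic -> (U <= U')%VS.
  move=> UU'; have /= := UU' X0; rewrite subrr mem0v => /(_ isT) X01.
  apply/subvP => u uU; have /= := UU' (u + X0); rewrite addrK => /(_ uU) uX.
  by have := rpredB uX X01; rewrite opprB addrA subrK addrK.
move=> [X0 [U [UE <-]]] [X1 [U' [UE' <-]]]; rewrite UE in UE'.
apply/eqP; rewrite eqn_leq; apply/andP; split; apply: dimvS.
  by apply: (sub X0 X1); rewrite UE'.
by apply: (sub X1 X0); rewrite UE'.
Qed.

Lemma has_dim_nonempty F d : has_dim F d -> (F !=set0)%classic.
Proof.
move=> [X0 [U [UE _]]]; have : aff_hull F X0 by rewrite UE /= subrr mem0v.
by move=> [k [p [a [Fp /sum1_neq0[i _] _]]]]; exists (p i).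
Qed.

Lemma affine_comb_sub k (p : 'I_k -> 'M[R]_n) (a : 'I_k -> R) X0 :
  \sum_i a i = 1 -> \sum_i a i *: p i - X0 = \sum_i a i *: (p i - X0).
Proof.
move=> a1; under [RHS]eq_bigr do rewrite scalerBr.
by rewrite sumrB -scaler_suml a1 scale1r.
Qed.

Lemma mixed_diff_comb k (a : 'I_k -> R) (f : 'I_k -> nat -> nat -> R) :
  mixed_diff n (fun i j => \sum_l a l * f l i j) = \sum_l a l *: mixed_diff n (f l).
Proof.
apply/matrixP => i j; rewrite mxE summxE -!sumrB -big_split /=.
by apply: eq_bigr => l _; rewrite !mxE; ring.
Qed.

Lemma mixed_diff_eq0 (f : nat -> nat -> R) : (forall j, f 0%N j = 0) ->
  (forall i, f i 0%N = 0) -> mixed_diff n f = 0 ->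
  forall i j, (i <= n)%N -> (j <= n)%N -> f i j = 0.
Proof.
move=> f0 f1 fE; elim=> [|i IHi] j i_n; first by rewrite f0.
elim: j => [|j IHj] jn; first by rewrite f1.
have /matrixP/(_ (Ordinal i_n) (Ordinal jn)) := fE; rewrite !mxE /=.
by rewrite IHj ?(ltnW jn) // !IHi ?(ltnW i_n) ?(ltnW jn) // !subr0 addr0.
Qed.

Definition region_mx (S : {set cell n}) : 'M[R]_n := asm_of R n (ind S).

Definition regions (G : grid n) : {set {set cell n}} :=
  [set S | doubly_directed_region G S]%SET.

Definition region_basis (G : grid n) : (num_regions G).-tuple 'M[R]_n :=
  [tuple region_mx (enum_val i) | i < #|regions G|].

Lemma region_enum_val (G : grid n) (i : 'I_#|regions G|) :
  doubly_directed_region G (enum_val i).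
Proof. by have := enum_valP i; rewrite inE. Qed.

Lemma region_basisE (G : grid n) (i : 'I_#|regions G|) :
  (region_basis G)`_i = region_mx (enum_val i).
Proof. by rewrite -tnth_nth tnth_mktuple. Qed.

(** A function that vanishes in row 0 and column 0 is determined by its mixed difference. Evaluating
    the combination at a cell of one region then isolates its coefficient, by disjointness. *)
Lemma region_basis_free (G : grid n) : free (region_basis G).
Proof.
apply/freeP => a a0 i.
pose f x y : R := \sum_(l < #|regions G|) a l * (ind (enum_val l) x y)%:R.
have fE : mixed_diff n f = 0.
  rewrite mixed_diff_comb -[RHS]a0; apply: eq_bigr => l _; congr (_ *: _).
  by rewrite region_basisE.
have outer x y : ~~ inner n x y -> f x y = 0.
  by move=> xy; rewrite /f big1 // => l _; rewrite ind_outer // mulr0.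
have [c cS] := region_cell (region_enum_val i).
have := @mixed_diff_eq0 f _ _ fE c.1.+1 c.2.+1.
have /andP[/andP[_ c1] /andP[_ c2]] := inner_pos c.
have o1 y : f 0%N y = 0 by apply: outer; rewrite /inner; lia.
have o2 y : f y 0%N = 0 by apply: outer; rewrite /inner; lia.
move=> /(_ o1 o2 (ltnW c1) (ltnW c2)).
rewrite /f (bigD1 i) //= ind_cell cS mulr1 big1 ?addr0 // => l li.
rewrite ind_cell; have [cl|_] := boolP (c \in enum_val l); last by rewrite mulr0.
case/eqP: li; apply: enum_val_inj.
by rewrite (region_component R (region_enum_val l) cl) -(region_component R (region_enum_val i) cS).
Qed.

Lemma face_dim F : is_face (@ASM_polytope R n) F -> (F !=set0)%classic ->
  has_dim F (num_regions (flow_grid_of_face F)).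
Proof.
move=> Ff Fn; set G := flow_grid_of_face F.
have [m [h [m1 hF hG cov]]] := face_family Ff Fn.
have hh k := (hF k).1.
have sepG := covered_separated R hh hG cov.
have [A0 [aA0 FA0]] := face_ASM Ff Fn.
have subG A : is_ASM A -> F A -> flow_grid_of A \subset G.
  by move=> aA FA; apply/fintype.subsetP => e eA; apply/(mem_flow_grid_of_face e Ff); exists A.
exists A0, <<region_basis G>>%VS; split; last first.
  by have := region_basis_free G; rewrite /free size_tuple => /eqP.
have dirA A : is_ASM A -> F A -> A - A0 \in <<region_basis G>>%VS.
  move=> aA FA; have := subG A aA FA; have := subG A0 aA0 FA0.
  have [h1 hh1 ->] := ASM_height aA; have [h0 hh0 ->] := ASM_height aA0.
  rewrite !flow_grid_of_asm // => s0 s1.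
  have dG := compat_height_diff R hh1 hh0 s1 s0.
  have -> : asm_of R n h1 - asm_of R n h0 = mixed_diff n (height_diff R n h1 h0).
    apply/matrixP => i j; rewrite !mxE !height_diffE // ?(ltnW (ltn_ord _)) //; ring.
  pose f x y : R := \sum_(l < #|regions G|)
    value_on (height_diff R n h1 h0) (enum_val l) * (ind (enum_val l) x y)%:R.
  have -> : mixed_diff n (height_diff R n h1 h0) = mixed_diff n f.
    congr mixed_diff; apply/funext => x; apply/funext => y.
    rewrite (compat_decomp x y sepG dG) /f -(@big_enum_val _ _ _ _ (mem (regions G))
      (fun S => value_on (height_diff R n h1 h0) S * (ind S x y)%:R)) /=.
    by apply: eq_bigl => S; rewrite inE.
  rewrite mixed_diff_comb; apply: rpred_sum => l _; apply: rpredZ; apply: memv_span.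
  by apply/tnthP; exists l; rewrite tnth_mktuple.
apply/seteqP; split=> X /=.
  move=> [k [p [a [Fp a1 ->]]]]; rewrite affine_comb_sub //.
  apply: rpred_sum => i _; apply: rpredZ.
  have [C [b [Cb FE]]] := Ff; have := Fp i; rewrite FE => -[PX CX].
  have [|k' [p' [a' [pA _ a1' ->]]]] := face_conv _ PX CX.
    by move=> A /ASM_in_polytope/Cb.
  rewrite affine_comb_sub //; apply: rpred_sum => l _; apply: rpredZ.
  have [aA CA] := pA l; apply: dirA => //; rewrite FE; split=> //; exact: ASM_in_polytope.
move=> XU; have {}XU : X - A0 \in <<region_basis G>>%VS := XU.
have -> : X = A0 + (X - A0) by rewrite addrC subrK.
rewrite (coord_span XU); elim/big_rec: _ => [|i Y _ FY].
  rewrite addr0; exists 1%N, (fun=> A0), (fun=> 1); split=> //; rewrite big_ord1 ?scale1r //.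
rewrite addrA addrAC.
set t := coord _ _ _; clearbody t.
rewrite (region_basisE i).
have [B hB BE] := round_region R hh hG cov (ltnW m1) (region_enum_val i).
(* The matrix of a region is a sum of differences of alternating sign matrices of [F], hence a
   translation that preserves the affine hull. *)
have -> : region_mx (enum_val i) = \sum_k (asm_of R n (B k) - asm_of R n (h k)).
  rewrite sumrB -!asm_of_sum (@eq_asm_of _ _ (fun i j => \sum_k B k i j)%N
    (fun x y => \sum_k h k x y + ind (enum_val i) x y)%N) => [|x y _ _]; last exact: BE.
  by rewrite asm_ofD addrAC subrr add0r.
apply: aff_hull_moves => // k; first by case: (hF k).
have [hBk sBk] := hB k; apply: face_grid_closed => //; first exact: asm_of_ASM.
by rewrite flow_grid_of_asm.
Qed.

End Dimension.

(** * Correspondence between faces and elementary flow grids *)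

Section FlowGridsOfFaces.
Variables (R : realType) (n : nat).
Local Open Scope ring_scope.
Implicit Types (A X : 'M[R]_n) (F : set 'M[R]_n) (G : grid n).

Lemma simple_flow_gridP G : simple_flow_grid G <->
  exists2 A : 'M[R]_n, is_ASM A & flow_grid_of A = G.
Proof.
split=> [/simple_grid_height[h hh ->]|[A /ASM_height[h hh ->] <-]].
  by exists (asm_of R n h); [exact: asm_of_ASM|rewrite flow_grid_of_asm].
by rewrite flow_grid_of_asm //; exact: simple_grid_of_height.
Qed.

Lemma face_elementary F : is_face (@ASM_polytope R n) F ->
  elementary_flow_grid (flow_grid_of_face F).
Proof.
move=> Ff.
exists [set S : grid n | `[< exists A, [/\ is_ASM A, F A & flow_grid_of A = S] >]]%SET.
  by move=> S; rewrite inE => /asboolP[A [aA _ AS]]; apply/simple_flow_gridP; exists A.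
apply/setP => e; apply/idP/finset.bigcupP.
  move=> /(mem_flow_grid_of_face e Ff)[A [aA FA eA]]; exists (flow_grid_of A) => //.
  by rewrite inE; apply/asboolP; exists A.
move=> [S]; rewrite inE => /asboolP[A [aA FA <-]] eA.
by apply/(mem_flow_grid_of_face e Ff); exists A.
Qed.

Lemma elementary_covered G : elementary_flow_grid G -> forall e, e \in G ->
  exists A : 'M[R]_n, [/\ is_ASM A, flow_grid_of A \subset G & e \in flow_grid_of A].
Proof.
move=> [X Xs GE] e; rewrite {1}GE => /finset.bigcupP[S SX eS].
have [A aA AS] := (simple_flow_gridP S).1 (Xs S SX); exists A; rewrite AS; split=> //.
by rewrite GE; exact: finset.bigcup_sup.
Qed.

(** The face is the zero set of [grid_functional], so its alternating sign matrices are those with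
    grid inside [G]. Their grids exhaust [G] because [G] is a union of simple flow grids, and an
    edge of [G] provides one such matrix. *)
Lemma elementary_face G : elementary_flow_grid G -> G != finset.set0 ->
  exists F, [/\ is_face (@ASM_polytope R n) F, (F !=set0)%classic
    & flow_grid_of_face F = G].
Proof.
move=> Ge /finset.set0Pn[e0 e0G]; have cov := elementary_covered Ge.
have [C CP] := grid_functional R G.
pose F := [set X | ASM_polytope X /\ Defs.dotmx C X = 0]%classic.
have Ff : is_face (@ASM_polytope R n) F.
  by exists C, 0; split=> // X; apply: polytope_le => A /CP[].
have FP A : is_ASM A -> F A <-> flow_grid_of A \subset G.
  move=> aA; split=> [[_ /(CP A aA).2 //]|AG].
  by split; [exact: ASM_in_polytope|apply/(CP A aA).2].
exists F; split=> //.
  by have [A [aA AG _]] := cov e0 e0G; exists A; apply/FP.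
apply/setP => e; apply/idP/idP.
  move=> /(mem_flow_grid_of_face e Ff)[A [aA /(FP A aA) AG eA]].
  exact: (fintype.subsetP AG).
move=> /cov[A [aA AG eA]]; apply/(mem_flow_grid_of_face e Ff).
by exists A; split=> //; apply/FP.
Qed.

Lemma face_complete_separated F : is_face (@ASM_polytope R n) F ->
  (F !=set0)%classic ->
  flow_grid_of_face F \subset complete_flow_grid n /\
  separated R (flow_grid_of_face F).
Proof.
move=> Ff Fn; have [m [h [_ hF hG cov]]] := face_family Ff Fn.
have hh k := (hF k).1.
by split; [exact: covered_complete cov|exact: covered_separated hh hG cov].
Qed.

Lemma flow_grid_of_face_inj F F' : is_face (@ASM_polytope R n) F ->
  is_face (@ASM_polytope R n) F' -> (F !=set0)%classic -> (F' !=set0)%classic ->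
  flow_grid_of_face F = flow_grid_of_face F' -> F = F'.
Proof.
have FP E : is_face (@ASM_polytope R n) E -> (E !=set0)%classic ->
    forall A, is_ASM A -> E A <-> flow_grid_of A \subset flow_grid_of_face E.
  move=> Ef En A aA; split=> [EA|]; last exact: face_grid_closed.
  by apply/fintype.subsetP => e eA; apply/(mem_flow_grid_of_face e Ef); exists A.
move=> Ff Ff' Fn Fn' FF; apply: face_eq => // A aA.
by rewrite (FP F) // (FP F') // FF.
Qed.

End FlowGridsOfFaces.

(** Representation of edges is rendered as a bijection between one-dimensional faces and elementary
    flow grids with a unique cycle. Nonemptiness is assumed in the first clause because the empty
    face has no dimension. *)
Theorem theorem4p4 (R : realType) (n : nat) :
  (forall F : set 'M[R]_n,
     is_face (@ASM_polytope R n) F -> (F !=set0)%classic ->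
     has_dim F (num_regions (flow_grid_of_face F))) /\
  (forall F : set 'M[R]_n,
     is_face (@ASM_polytope R n) F -> has_dim F 1 ->
     elementary_flow_grid (flow_grid_of_face F) /\
     exists! E : {set edge n}, double_directed_cycle (flow_grid_of_face F) E) /\
  (forall G : grid n,
     elementary_flow_grid G ->
     (exists! E : {set edge n}, double_directed_cycle G E) ->
     exists! F : set 'M[R]_n,
       [/\ is_face (@ASM_polytope R n) F, has_dim F 1
         & flow_grid_of_face F = G]).
Proof.
split; first by move=> F; exact: face_dim.
split=> [F Ff F1|G Ge G1].
  have Fn := has_dim_nonempty F1; split; first exact: face_elementary.
  have [FC sepF] := face_complete_separated Ff Fn.
  apply: (one_region_one_cycle FC sepF).
  exact: has_dim_uniq (face_dim Ff Fn) F1.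
have Gn : G != finset.set0.
  have [E [[c [c2 /andP[cyc _] _]] _]] := G1.
  case: c c2 cyc => // v c _ cyc; apply/finset.set0Pn.
  exists (v, next (v :: c) v).
  by have /andP[] := next_cycle cyc (mem_head v c).
have [F [Ff Fn FG]] := elementary_face R Ge Gn.
have [FC sepF] := face_complete_separated Ff Fn.
have F1 : has_dim F 1.
  have <- : num_regions (flow_grid_of_face F) = 1; last exact: face_dim.
  by apply: (one_cycle_one_region FC sepF); rewrite FG.
exists F; split=> [//|F' [Ff' F1' FG']].
have Fn' := has_dim_nonempty F1'.
exact: flow_grid_of_face_inj Ff Ff' Fn Fn' (etrans FG (esym FG')).
Qed.
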